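(* Let $m,k,n\ge 1$, let $A$ be a real $m\times m$ matrix and $B$ a real $m\times k$ matrix with $\operatorname{rank}[B, AB, \dots, A^{m-1}B]=m$. Let $g:\mathbb{R}^k\times\mathbb{R}^m\times\mathbb{R}^n\to\mathbb{R}^n$ be Borel measurable and bounded, $\sup_{(u,y,z)}\|g(u,y,z)\|=M_g<\infty$, and Lipschitz continuous in $(y,z)$ uniformly with respect to $u\in\mathbb{R}^k$. Fix $y_0\in\mathbb{R}^m$, $z_0\in\mathbb{R}^n$ and $T>0$. For $\varepsilon>0$ consider the system $$\varepsilon\,\frac{dy(t)}{dt}=Ay(t)+Bu(t),\quad y(0)=y_0,\qquad \frac{dz(t)}{dt}=g(u(t),y(t),z(t)),\quad z(0)=z_0,$$ on $[0,T]$, and let $\mathcal{Z}_T(\varepsilon)$ be the set of all $z$-components $z(\cdot)$ of solutions $(u(\cdot),y(\cdot),z(\cdot))$ of this system, where the control $u(\cdot)$ ranges over measurable functions $[0,T]\to\mathbb{R}^k$ for which the system has a solution. For $z\in\mathbb{R}^n$ let $$V(z):=\overline{\mathrm{co}}\,\{g(u,y,z):\ u\in\mathbb{R}^k,\ y\in\mathbb{R}^m\}$$ (closure of the convex hull), and let $\mathcal{Z}_T$ be the set of solutions on $[0,T]$ of the differential inclusion $\frac{dz(t)}{dt}\in V(z(t))$, $z(0)=z_0$. Then for every $\varepsilon>0$, $$\mathrm{cl}(\mathcal{Z}_T(\varepsilon))=\mathcal{Z}_T,$$ where $\mathrm{cl}$ denotes closure with respect to the uniform convergence metric on $[0,T]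$.
   Context: Solutions of the differential inclusion are absolutely continuous functions $z:[0,T]\to\mathbb{R}^n$ with $z(0)=z_0$ and $\dot z(t)\in V(z(t))$ for almost every $t\in[0,T]$. Solutions of the control system are understood in the Carathéodory (absolutely continuous) sense. *)

(* Defs.v *)
From HB Require Import structures.
From mathcomp Require Import all_boot all_order all_algebra.
From mathcomp Require Import all_classical all_reals all_analysis.
Set Implicit Arguments. Unset Strict Implicit. Unset Printing Implicit Defensive.
Import Order.TTheory GRing.Theory Num.Theory.
Import numFieldNormedType.Exports.
Local Open Scope classical_set_scope.
Local Open Scope ring_scope.

Section Defs.
Variable R : realType.

Definition leb_measurable (A : set R) : Prop :=
  exists B : set (measurableTypeR R), measurable B /\
    (@lebesgue_measure R).-negligible ((A `\` B) `|` (B `\` A)).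

Definition meas_on (T : R) (X : topologicalType) (u : R -> X) : Prop :=
  forall O : set X, open O -> leb_measurable (`[0, T]%classic `&` u @^-1` O).

Definition borel_measurable (X Y : topologicalType) (f : X -> Y) : Prop :=
  forall O : set Y, open O -> <<s (@open X) >> (f @^-1` O).

Definition abs_cont_on (V : normedModType R) (a b : R) (f : R -> V) : Prop :=
  forall e : R, 0 < e -> exists2 d : R, 0 < d &
    forall (N : nat) (s t : 'I_N -> R),
      (forall i, a <= s i /\ s i <= t i /\ t i <= b) ->
      (forall i j, i != j -> t i <= s j \/ t j <= s i) ->
      \sum_(i < N) (t i - s i) < d ->
      \sum_(i < N) `|f (t i) - f (s i)| < e.

Definition ae_on (T : R) (P : R -> Prop) : Prop :=
  {ae (@lebesgue_measure R), forall t, `[0, T]%classic t -> P t}.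

Definition conv_hull (V : lmodType R) (S : set V) : set V :=
  [set x | exists (N : nat) (lam : 'I_N -> R) (p : 'I_N -> V),
     (forall i, 0 <= lam i) /\ \sum_(i < N) lam i = 1 /\ (forall i, S (p i)) /\
     x = \sum_(i < N) lam i *: p i].

Definition closed_conv_hull (V : normedModType R) (S : set V) : set V :=
  closure (conv_hull S).

Definition unif_closure (V : normedModType R) (T : R) (S : set (R -> V)) : set (R -> V) :=
  [set z | forall e : R, 0 < e -> exists2 w, S w &
     forall t, `[0, T]%classic t -> `|z t - w t| <= e].

(* Kalman controllability matrix [B, AB, ..., A^(l-1)B] *)
Fixpoint ctrb (m k : nat) (A : 'M[R]_m) (B : 'M[R]_(m, k)) (l : nat) : 'M[R]_(m, l * k) :=
  match l with
  | 0 => 0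
  | l'.+1 => row_mx B (A *m ctrb A B l')
  end.

Definition Z_eps (m k n : nat) (A : 'M[R]_m) (B : 'M[R]_(m, k))
  (g : 'cV[R]_k -> 'cV[R]_m -> 'cV[R]_n -> 'cV[R]_n)
  (y0 : 'cV[R]_m) (z0 : 'cV[R]_n) (T eps : R) : set (R -> 'cV[R]_n) :=
  [set z | exists (u : R -> 'cV[R]_k) (y : R -> 'cV[R]_m),
     meas_on T u /\
     abs_cont_on 0 T y /\ y 0 = y0 /\
     ae_on T (fun t => derivable y t 1 /\ eps *: 'D_1 y t = A *m y t + B *m u t) /\
     abs_cont_on 0 T z /\ z 0 = z0 /\
     ae_on T (fun t => derivable z t 1 /\ 'D_1 z t = g (u t) (y t) (z t))].

Definition Vset (m k n : nat)
  (g : 'cV[R]_k -> 'cV[R]_m -> 'cV[R]_n -> 'cV[R]_n) (z : 'cV[R]_n) : set 'cV[R]_n :=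
  closed_conv_hull [set g u y z | u in [set: 'cV[R]_k] & y in [set: 'cV[R]_m]].

Definition Z_incl (m k n : nat)
  (g : 'cV[R]_k -> 'cV[R]_m -> 'cV[R]_n -> 'cV[R]_n)
  (z0 : 'cV[R]_n) (T : R) : set (R -> 'cV[R]_n) :=
  [set z | abs_cont_on 0 T z /\ z 0 = z0 /\
     ae_on T (fun t => derivable z t 1 /\ Vset g (z t) ('D_1 z t))].

End Defs.

(* Main.v *)
(* The inclusion from left to right is closedness: all solutions are
   [M]-Lipschitz, so a uniform limit [z] is Lipschitz and differentiable almost
   everywhere, and its difference quotients at [t] are limits of
   averages of derivatives lying close to the convex set [V(z(t))].

   For the converse, [z] is followed on a fine grid.  On a cell the increment
   of [z] is close to a convex combination of vectors [g(u_j, y_j, z)].  Each of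
   them is realized by chattering: controllability brings [y] back to [y_j] in
   an arbitrarily small fraction of the time, whatever [eps] is, and in between
   the constant control [u_j] is applied so briefly that [y] hardly moves.  As
   [g] is merely Borel in [u], all controls are kept piecewise constant, so that
   the classical Picard theorem provides the trajectories; steering with [m]
   constant pieces of small length [h] is possible because the sampled
   controllability matrix, after taking difference quotients, converges to the
   Kalman matrix.  A discrete Gronwall estimate sums up the errors. *)
Require Import Defs.
From HB Require Import structures.
From mathcomp Require Import all_boot all_order all_algebra.
From mathcomp Require Import all_classical all_reals all_analysis.
From mathcomp Require Import measurable_realfun ring lra.
Set Implicit Arguments. Unset Strict Implicit. Unset Printing Implicit Defensive.
Import Order.TTheory GRing.Theory Num.Theory.
Import numFieldNormedType.Exports.
Local Open Scope classical_set_scope.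
Local Open Scope ring_scope.

(** * Derivatives and Cousin's lemma *)

Section Derivatives.
Context {R : realType} {V : normedModType R}.
Implicit Types (f : R -> V) (t : R) (l : V).

(** Quantified form of the derivative, without punctured neighbourhoods, made for direct use in
    estimates. *)
Definition has_deriv f t l := forall e : R, 0 < e -> exists2 d : R, 0 < d &
  forall s, `|s - t| < d -> `|f s - f t - (s - t) *: l| <= e * `|s - t|.

Lemma has_derivP f t l : has_deriv f t l <-> derivable f t 1 /\ 'D_1 f t = l.
Proof.
split=> [fl|[df <-] e e0].
  have cl : h^-1 *: (f (h *: 1 + t) - f t) @[h --> 0^'] --> l.
    apply/cvgrPdist_le => e /fl[d d0 H].
    near=> h.
    have h0 : h != 0 by near: h; exact: nbhs_dnbhs_neq.
    have hd : `|h| < d by near: h; exact: dnbhs0_lt.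
    have := H (h + t); rewrite addrK => /(_ hd).
    rewrite [h *: 1]mulr1 distrC -{2}(scalerK h0 l) -scalerBr normrZ normfV.
    by rewrite ler_pdivrMl ?normr_gt0// mulrC.
  split; first by apply/cvg_ex; exists l.
  exact/cvg_lim.
have /cvgrPdist_le/(_ e e0)[d /= d0 H] : h^-1 *: (f (h *: 1 + t) - f t) @[h --> 0^'] --> 'D_1 f t by [].
exists d => // s sd; have [->|st] := eqVneq s t.
  by rewrite !subrr scale0r subrr !normr0 mulr0.
have h0 : s - t != 0 by rewrite subr_eq0.
have := H (s - t); rewrite /ball_ /= sub0r normrN => /(_ sd h0).
rewrite [_ *: 1]mulr1 subrK distrC -{1}(scalerK h0 ('D_1 f t)) -scalerBr normrZ normfV.
by rewrite ler_pdivrMl ?normr_gt0// mulrC.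
Unshelve. all: by end_near. Qed.

Lemma has_deriv_eq_near f g t l (d : R) : 0 < d ->
  (forall s, `|s - t| < d -> f s = g s) -> has_deriv f t l -> has_deriv g t l.
Proof.
move=> d0 fg fl e /fl[d1 d10 H]; exists (Num.min d d1); first by rewrite lt_min d0.
move=> s; rewrite lt_min => /andP[sd sd1]; rewrite -!fg ?H//.
by rewrite subrr normr0.
Qed.

Lemma has_deriv_shift f t l c : has_deriv f (t - c) l ->
  has_deriv (fun s => f (s - c)) t l.
Proof.
move=> fl e /fl[d d0 H]; exists d => // s sd.
by have := H (s - c); rewrite opprB addrA subrK; exact.
Qed.

Lemma has_derivD f g t l l' : has_deriv f t l -> has_deriv g t l' ->
  has_deriv (fun s => f s + g s) t (l + l').
Proof.
move=> /has_derivP[df <-] /has_derivP[dg <-]; apply/has_derivP.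
by split; [exact: derivableD|rewrite -deriveD].
Qed.

Lemma has_derivB f g t l l' : has_deriv f t l -> has_deriv g t l' ->
  has_deriv (fun s => f s - g s) t (l - l').
Proof.
move=> /has_derivP[df <-] /has_derivP[dg <-]; apply/has_derivP.
by split; [exact: derivableB|rewrite -deriveB].
Qed.

Lemma has_deriv_cst (c : V) t : has_deriv (fun=> c) t 0.
Proof. by move=> e e0; exists 1 => // s _; rewrite scaler0 !subrr normr0 mulr_ge0// ltW. Qed.

Lemma has_deriv_continuous f t l : has_deriv f t l -> {for t, continuous f}.
Proof. by move=> /has_derivP[df _]; exact/differentiable_continuous/derivable1_diffP. Qed.

Lemma has_deriv_near f t l : has_deriv f t l ->
  forall e : R, 0 < e -> exists2 d : R, 0 < d & forall s, `|s - t| < d -> `|f s - f t| <= e.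
Proof.
move=> fl e e0; have [d d0 H] := fl 1 ltr01.
have l1 : 0 < 1 + `|l| by rewrite ltr_pwDl.
exists (Num.min d (e / (1 + `|l|))); first by rewrite lt_min d0 divr_gt0.
move=> s; rewrite lt_min => /andP[/H h]; rewrite ltr_pdivlMr// => h'.
rewrite -(subrK ((s - t) *: l) (f s - f t)) (le_trans (ler_normD _ _))//.
by rewrite normrZ; lra.
Qed.

End Derivatives.

Lemma subrBZ (R : pzRingType) (V : lmodType R) (p q l : V) (a b : R) :
  (p - a *: l) - (q - b *: l) + (a - b) *: l = p - q.
Proof.
by rewrite scalerBl opprD opprK addrACA subrK addrK.
Qed.

(** With [t] between [x] and [y], the errors at the two end points are at most [e * (t - x)] and
    [e * (y - t)], which add up exactly. Cousin's lemma turns this local estimate into a global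
    one. *)
Lemma has_deriv_straddle {R : realType} {V : normedModType R} (f : R -> V) t l :
  has_deriv f t l -> forall e : R, 0 < e -> exists2 d : R, 0 < d &
  forall x y, x <= t -> t <= y -> y - x < d ->
    `|f y - f x - (y - x) *: l| <= e * (y - x).
Proof.
move=> fl e e0; have [d d0 H] := fl e e0.
exists d => // x y xt ty yxd.
have hx := H x; have hy := H y.
rewrite ler0_norm ?subr_le0// in hx; rewrite ger0_norm ?subr_ge0// in hy.
have {}hx := hx ltac:(lra); have {}hy := hy ltac:(lra).
have -> : f y - f x - (y - x) *: l =
    (f y - f t - (y - t) *: l) - (f x - f t - (x - t) *: l).
  rewrite (_ : y - x = (y - t) - (x - t)); last by ring.
  apply/eqP; rewrite subr_eq; apply/eqP.
  by rewrite subrBZ opprB subrKA.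
rewrite (le_trans (ler_normB _ _))//; lra.
Qed.

(** * Cousin's lemma and the mean value inequality *)

Section Cousin.
Context {R : realType}.

(** By additivity, the supremum of all [x] with [P a x] has the property itself, and it could be
    exceeded if it were less than [b]. *)
Lemma cousin (a b : R) (P : R -> R -> Prop) : a <= b ->
  (forall x y z, a <= x -> x <= y -> y <= z -> z <= b -> P x y -> P y z -> P x z) ->
  (forall t, a <= t <= b -> exists2 d : R, 0 < d &
    forall x y, a <= x -> x <= t -> t <= y -> y <= b -> y - x < d -> P x y) ->
  P a b.
Proof.
move=> ab Padd Ploc.
pose S := [set x | a <= x <= b /\ P a x].
have Sa : S a.
  split; first by rewrite lexx.
  have [d d0 H] := Ploc a (introT andP (conj (lexx a) ab)).
  by apply: H => //; rewrite subrr.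
have hS : has_sup S.
  by split; [exists a|exists b => x [/andP[]]].
pose s := sup S.
have as_ : a <= s by exact: ub_le_sup hS.2 _ Sa.
have sb : s <= b by apply: ge_sup; [exact: hS.1|move=> x [/andP[]]].
have [d d0 H] := Ploc s (introT andP (conj as_ sb)).
have [x [/andP[ax xb] Pax] sx] := sup_adherent d0 hS.
have xs : x <= s by apply: ub_le_sup hS.2 _ _; split=> //; rewrite ax.
pose y := Num.min b (s + d / 2).
have [yb Py] : y <= b /\ forall y', s <= y' -> y' <= b -> y' - x < d -> P a y'.
  split; first by rewrite ge_min lexx.
  by move=> y' sy y'b yd; apply: (Padd _ x) => //; [exact: le_trans sy|exact: H].
suff : s = b.
  move=> <-; apply: Py => //; rewrite -/s in sx; lra.
apply/eqP; rewrite eq_le sb /= leNgt; apply/negP => sltb.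
pose e := Num.min (b - s) ((d - (s - x)) / 2).
have e0 : 0 < e by rewrite lt_min subr_gt0 sltb /=; rewrite -/s in sx; lra.
have e1 : e <= b - s by rewrite ge_min lexx.
have e2 : e <= (d - (s - x)) / 2 by rewrite ge_min lexx orbT.
have : S (s + e).
  split; first by apply/andP; split; lra.
  apply: Py; [lra|lra|rewrite -/s in sx; lra].
by move=> /(ub_le_sup hS.2); rewrite -/s; lra.
Qed.

(** The bound with the slightly larger constant [K + e'] is additive over adjacent intervals and
    holds on short ones by the straddle estimate. *)
Lemma mean_value_ineq (V : normedModType R) (f f' : R -> V) (a b K : R) : a <= b ->
  (forall t, a <= t <= b -> has_deriv f t (f' t)) ->
  (forall t, a <= t <= b -> `|f' t| <= K) -> `|f b - f a| <= K * (b - a).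
Proof.
move=> ab df fK; apply/ler_addgt0Pr => e e0.
pose e' := e / (b - a + 1).
have ba : 0 <= b - a by rewrite subr_ge0.
have e'0 : 0 < e' by rewrite divr_gt0//; lra.
suff : `|f b - f a| <= (K + e') * (b - a).
  move=> /le_trans; apply; rewrite mulrDl lerD2l /e' -mulrA ler_piMr ?(ltW e0)//.
  by rewrite mulrC ler_pdivrMr ?mul1r; lra.
apply: (@cousin _ _ (fun x y => `|f y - f x| <= (K + e') * (y - x))) => //.
  move=> x y z _ _ _ _ h1 h2; rewrite -(subrKA (f y)).
  rewrite (le_trans (ler_normD _ _))//; lra.
move=> t tab; have [d d0 H] := has_deriv_straddle (df t tab) e'0.
exists d => // x y ax xt ty yb yxd.
rewrite -(subrK ((y - x) *: f' t) (f y - f x)) (le_trans (ler_normD _ _))//.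
rewrite mulrDl addrC lerD ?H// normrZ ger0_norm 1?mulrC ?ler_wpM2r ?fK//; lra.
Qed.

End Cousin.

(** * Projection onto an interval *)

Section Clamp.
Context {R : realType} (a b : R).

(** Composition with this projection extends a function from [a, b] to the whole line and preserves
    continuity. *)
Definition clamp (x : R) := Num.max a (Num.min x b).

Lemma clamp_itv x : a <= b -> a <= clamp x <= b.
Proof. by move=> ab; rewrite le_max lexx /= ge_max ab ge_min lexx orbT. Qed.

Lemma clamp_id x : a <= x <= b -> clamp x = x.
Proof. by move=> /andP[ax xb]; rewrite /clamp (min_idPl xb) (max_idPr ax). Qed.

Lemma clamp_homo x y : a <= b -> x <= y -> 0 <= clamp y - clamp x <= y - x.
Proof.
move=> ab xy; rewrite /clamp /Order.max /Order.min.
by case: (ltP x b) => ?; case: (ltP y b) => ?; do ?case: (ltP a _) => ?;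
  apply/andP; split; lra.
Qed.

Lemma clamp_continuous : a <= b -> continuous clamp.
Proof.
move=> ab x; apply/cvgrPdist_le => e e0; near=> y.
have : `|x - y| <= e by near: y; apply: cvgr_dist_le => //; exact: cvg_id.
apply: le_trans; have [xy|/ltW yx] := leP x y.
  have /andP[h1 h2] := clamp_homo ab xy.
  by rewrite [leLHS]distrC [leRHS]distrC !ger0_norm// subr_ge0.
have /andP[h1 h2] := clamp_homo ab yx.
by rewrite !ger0_norm// subr_ge0.
Unshelve. all: by end_near. Qed.

End Clamp.

Lemma continuous_itv_bounded {R : realType} (V : normedModType R) (f : R -> V)
    (a b : R) : a <= b -> (forall t, a <= t <= b -> {for t, continuous f}) ->
  exists K, forall t, a <= t <= b -> `|f t| <= K.
Proof.
move=> ab cf.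
have cfc : continuous (fun t => `|f (clamp a b t)|).
  move=> t; apply: (@continuous_comp _ _ _ (f \o clamp a b) Num.norm).
    by apply: continuous_comp; [exact: clamp_continuous|exact/cf/clamp_itv].
  exact: norm_continuous.
have [t1 _ Ht1] := EVT_max ab (continuous_subspaceT cfc (A := `[a, b])).
eexists => t ht; have := Ht1 t; rewrite (clamp_id ht) in_itv/= => /(_ ht); exact.
Qed.

(** * Mean values of absolutely continuous functions *)

Section AbsolutelyContinuousMeanValue.
Context {R : realType}.
Notation mu := (@lebesgue_measure R).

Lemma negligible_open_cover (E : set R) (d : R) : 0 < d -> mu.-negligible E ->
  exists U : set R, [/\ open U, E `<=` U & (mu U < d%:E)%E].
Proof.
move=> d0 [A [mA A0 EA]].
have Aoo : (mu A < +oo)%E by rewrite A0 ltry.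
have [U [oU AU UAd]] := lebesgue_regularity_outer mA Aoo d0.
exists U; split => //; first exact: subset_trans AU.
have -> : U = (U `\` A) `|` A by rewrite setUC setDUK.
rewrite measureU //; last 2 first.
- by apply: measurableD => //; exact: open_measurable.
- by rewrite setIC; apply/seteqP; split => // x [? []].
by rewrite [X in (_ + X)%E](_ : _ = 0%E)// adde0.
Qed.

(** Intervals inside [x, y], listed from left to right. Unlike the indexed families of
    [abs_cont_on], such lists are easily concatenated, as the use of Cousin's lemma demands. *)
Fixpoint chain (x y : R) (s : seq (R * R)) : Prop :=
  match s with
  | [::] => x <= y
  | p :: s' => [/\ x <= p.1, p.1 <= p.2 & chain p.2 y s']
  end.

Lemma chain_le x y z s : x <= y -> chain y z s -> chain x z s.
Proof.
case: s => [|p s] /= xy; first exact: le_trans.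
by case=> /(le_trans xy).
Qed.

Lemma chain_cat x y z s s' : chain x y s -> chain y z s' -> chain x z (s ++ s').
Proof.
elim: s x => [|p s IH] x /=; first exact: chain_le.
by move=> [? ? c1] c2; split => //; exact: IH.
Qed.

Lemma chain_bounds x y s i : chain x y s -> (i < size s)%N ->
  [/\ x <= (nth 0 s i).1, (nth 0 s i).1 <= (nth 0 s i).2 & (nth 0 s i).2 <= y].
Proof.
elim: s x i => [|p s IH] x [|i] //= [xp pp c] si.
  split => //; elim: s p.2 c {IH si} => //= q s IH r [rq qq /IH]; lra.
by have [] := IH _ _ c si; split => //; lra.
Qed.

Lemma chain_nonoverlap x y s i j : chain x y s -> (i < j < size s)%N ->
  (nth 0 s i).2 <= (nth 0 s j).1.
Proof.
elim: s x i j => [|p s IH] x [|i] [|j] //= [xp pp c] ijs.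
  by have [] := chain_bounds c ijs.
exact: IH c ijs.
Qed.

Lemma chain_sum_ge0 x y s : chain x y s -> 0 <= \sum_(p <- s) (p.2 - p.1).
Proof.
elim: s x => [|p s IH] x /=; first by rewrite big_nil.
by move=> [_ pp /IH]; rewrite big_cons; lra.
Qed.

Lemma abs_cont_on_chain (V : normedModType R) (a b : R) (f : R -> V) :
  abs_cont_on a b f -> forall e : R, 0 < e -> exists2 d : R, 0 < d &
  forall s, chain a b s -> \sum_(p <- s) (p.2 - p.1) < d ->
    \sum_(p <- s) `|f p.2 - f p.1| < e.
Proof.
move=> ac e /ac[d d0 H]; exists d => // s cs.
have sumE (F : R * R -> R) : \sum_(p <- s) F p = \sum_(i < size s) F (nth 0 s i).
  by rewrite (big_nth 0) big_mkord.
rewrite !sumE => sd.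
apply: (H (size s) (fun i => (nth 0 s i).1) (fun i => (nth 0 s i).2)) => //.
  by move=> i; have [] := chain_bounds cs (ltn_ord i).
move=> i j; rewrite neq_ltn => /orP[ij|ji]; [left|right].
  by apply: (chain_nonoverlap cs); rewrite ij ltn_ord.
by apply: (chain_nonoverlap cs); rewrite ji ltn_ord.
Qed.

(** Here closed means stable under convex combinations of two points, not topologically closed. *)
Definition convex_closed (V : lmodType R) (C : set V) := forall x y (u v : R),
  C x -> C y -> 0 <= u -> 0 <= v -> u + v = 1 -> C (u *: x + v *: y).

(* Away from a small open set [U] covering the exceptional null set, short
   increments of [f] are governed by the derivative; the increments over the
   intervals inside [U] are collected in a chain, where absolute continuity
   makes their sum negligible. *)
Lemma abs_cont_mean_value (V : normedModType R) (f : R -> V) (a b : R)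
    (C : set V) (E : set R) :
  a <= b -> abs_cont_on a b f -> convex_closed C -> C !=set0 ->
  mu.-negligible E ->
  (forall t, a <= t <= b -> ~ E t -> exists2 l, has_deriv f t l & C l) ->
  forall e : R, 0 < e -> exists2 c, C c & `|f b - f a - (b - a) *: c| <= e.
Proof.
move=> ab ac cC [c0 Cc0] nE df e e0.
pose e1 := e / (b - a + 3).
have e10 : 0 < e1 by rewrite divr_gt0//; lra.
have [d0 d00 acd] := abs_cont_on_chain ac e10.
pose d := Num.min d0 (e1 / (`|c0| + 1)).
have c1 : 0 < `|c0| + 1 by rewrite ltr_wpDl.
have d_gt0 : 0 < d by rewrite lt_min d00 divr_gt0.
have [U [oU EU Ud]] := negligible_open_cover d_gt0 nE.
have mU : measurable U by exact: open_measurable.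
(* Half-open intervals make [m] additive; [m a b < d] will bound the total length of the chain. *)
pose m x y := fine (mu (U `&` `]x, y])).
have mI x y : measurable (U `&` `]x, y]) by exact: measurableI.
have fI x y : mu (U `&` `]x, y]) \is a fin_num.
  rewrite ge0_fin_numE// (le_lt_trans (measureIl _ _ _))//.
  by rewrite (lt_trans Ud)// ltry.
have mD x y z : x <= y -> y <= z -> m x z = m x y + m y z.
  move=> xy yz; rewrite /m -fineD// -measureU; [|exact: mI|exact: mI|]; last first.
    apply/seteqP; split => // t [[_ /=]]; rewrite in_itv /= => /andP[_ ty] [_ /=].
    by rewrite in_itv/= => /andP[yt _]; move: (lt_le_trans yt ty); rewrite ltxx.
  by rewrite -setIUr -itv_bndbnd_setU.
have mfull x y : x <= y -> `[x, y] `<=` U -> m x y = y - x.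
  move=> xy sU; rewrite /m (_ : _ `&` _ = `]x, y]%classic); last first.
    apply/seteqP; split => [t []//|t xty]; split => //; apply: sU.
    exact: subset_itv_oc_cc.
  rewrite lebesgue_measure_itv /= lte_fin; case: ltP => //= yx.
  by apply/eqP; rewrite eq_sym subr_eq0 eq_le xy yx.
have mab : m a b < d.
  rewrite -lte_fin fineK// (le_lt_trans _ Ud)// measureIl//.
pose P x y := exists s c, [/\ chain x y s, \sum_(p <- s) (p.2 - p.1) <= m x y, C c &
  `|f y - f x - (y - x) *: c| <=
    e1 * (y - x) + \sum_(p <- s) (`|f p.2 - f p.1| + `|c0| * (p.2 - p.1))].
have : P a b.
  apply: cousin => // [x y z ax xy yz zb [s1 [c1' [ch1 l1 C1 H1]]] [s2 [c2 [ch2 l2 C2 H2]]]|t tab].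
    have [xey|xny] := eqVneq x y.
      by exists s2, c2; rewrite xey.
    have zx : 0 < z - x by rewrite subr_gt0 (lt_le_trans _ yz)// lt_neqAle xny.
    (* Weights proportional to the lengths keep the vector in [C] and make the linear terms add
       up. *)
    exists (s1 ++ s2), ((y - x) / (z - x) *: c1' + (z - y) / (z - x) *: c2).
    rewrite !big_cat /= (mD _ y)//; split.
    - exact: chain_cat ch2.
    - exact: lerD.
    - apply: cC => //; [by rewrite divr_ge0 ?(ltW zx)// subr_ge0..|].
      by rewrite -mulrDl addrC subrKA divff// gt_eqF.
    - rewrite scalerDr !scalerA !(mulrC (z - x)) !mulfVK ?gt_eqF//.
      have -> : f z - f x - ((y - x) *: c1' + (z - y) *: c2) =
          (f z - f y - (z - y) *: c2) + (f y - f x - (y - x) *: c1').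
        by rewrite addrACA subrKA opprD (addrC (- (_ *: c1'))).
      rewrite (le_trans (ler_normD _ _))//; lra.
  have [Et|nEt] := pselect (E t).
    have /nbhs_ballP[r /= r0 rU] : nbhs t U by apply: open_nbhs_nbhs; split => //; exact: EU.
    exists r => // x y ax xt ty yb yxr.
    (* Around an exceptional point the whole interval enters the chain, and the fixed vector [c0]
       serves as velocity. *)
    exists [:: (x, y)], c0; rewrite !big_seq1 /=; split => //.
    - by split => //; exact: le_trans ty.
    - rewrite mfull// ?(le_trans xt ty)// => s /=; rewrite in_itv/= => /andP[xs sy].
      by apply: rU; rewrite /ball /= ltr_distlC; apply/andP; split; lra.
    - rewrite (le_trans (ler_normB _ _))// normrZ ger0_norm ?subr_ge0 ?(le_trans xt ty)//.
      rewrite (mulrC `|c0|) ler_wpDl// mulr_ge0 ?(ltW e10)//.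
      by rewrite subr_ge0 (le_trans xt ty).
  have [l fl Cl] := df t tab nEt.
  have [r r0 H] := has_deriv_straddle fl e10.
  exists r => // x y ax xt ty yb yxr; exists [::], l; rewrite !big_nil addr0; split => //.
  - exact: le_trans ty.
  - exact: fine_ge0.
  - exact: H.
case=> s [c [ch len Cc H]]; exists c => //; apply: (le_trans H).
have lend := le_lt_trans len mab.
have sd0 : \sum_(p <- s) (p.2 - p.1) < d0 by apply: (lt_le_trans lend); rewrite ge_min lexx.
have sd1 : \sum_(p <- s) (p.2 - p.1) < e1 / (`|c0| + 1).
  by apply: (lt_le_trans lend); rewrite ge_min lexx orbT.
have h1 := acd s ch sd0.
rewrite big_split /= -mulr_sumr.
have h2 : `|c0| * \sum_(p <- s) (p.2 - p.1) <= e1.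
  rewrite ltr_pdivlMr// in sd1.
  have s0 := chain_sum_ge0 ch.
  lra.
have -> : e = e1 * (b - a + 3) by rewrite /e1 mulfVK// gt_eqF//; lra.
lra.
Qed.

End AbsolutelyContinuousMeanValue.

(** * Differentiability of Lipschitz functions *)

Section LipschitzDifferentiability.
Context {R : realType}.
Notation mu := (@lebesgue_measure R).
Import lebesgue_stieltjes_measure.

(** Both measures are infima over countable covers by half-open intervals, and the Stieltjes length
    of each interval is at most its ordinary length. *)
Lemma stieltjes_le_lebesgue (G : cumulative R R) (A : set R) :
  (forall x y, x <= y -> G y - G x <= y - x) ->
  (lebesgue_stieltjes_measure G A <= mu A)%E.
Proof.
move=> Glip; apply: le_ereal_inf_tmp => _ [F cF <-].
apply: (@le_trans _ _ (\sum_(0 <= k <oo) wlength G (F k))%E).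
  by apply: ereal_inf_lbound; exists F.
apply: lee_nneseries => [k _ _|k _]; first exact: wlength_ge0.
have [mF _] := cF; have /ocitvP[->|[[x y] /= xy ->]] := mF k.
  by rewrite !wlength0.
by rewrite !wlength_itv_bnd ?(ltW xy)// lee_fin Glip// ltW.
Qed.

(* The Stieltjes measure of [G] is dominated by Lebesgue measure, so its
   Radon-Nikodym density is the almost everywhere derivative of [G]. *)
Lemma monotone_lipschitz_ae_derivable (G : R -> R) (a b : R) :
  (forall x y, x <= y -> 0 <= G y - G x <= y - x) ->
  {ae mu, forall t, a < t < b -> derivable G t 1}.
Proof.
move=> Glip.
have Gnd : nondecreasing G by move=> x y /Glip; rewrite subr_ge0 => /andP[].
have Grc : right_continuous G.
  move=> x; apply: cvg_at_right_filter; apply/cvgrPdist_le => e e0; near=> y.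
  have : `|x - y| <= e by near: y; apply: cvgr_dist_le => //; exact: cvg_id.
  apply: le_trans; case: (leP x y) => [xy|/ltW yx].
    rewrite [leLHS]distrC [leRHS]distrC !ger0_norm ?subr_ge0 ?Gnd//.
    by have /andP[] := Glip _ _ xy.
  rewrite !ger0_norm ?subr_ge0 ?Gnd//.
  by have /andP[] := Glip _ _ yx.
pose Gc : cumulative R R := HB.pack G (isCumulative.Build R _ R G Gnd Grc).
pose nu0 := lebesgue_stieltjes_measure Gc.
have nu0_le A : (nu0 A <= mu A)%E.
  by apply: stieltjes_le_lebesgue => x y /Glip /andP[].
have mD : measurable (`]a, b]%classic : set (measurableTypeR R)) by exact: measurable_itv.
have nuD : (nu0 `]a, b]%classic < +oo)%E.
  by rewrite (le_lt_trans (nu0_le _))// lebesgue_measure_itv/=; case: ifP; rewrite -?EFinB ltry.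
pose nu : {finite_measure set (measurableTypeR R) -> \bar R} := mfrestr mD nuD.
have nu_mu : nu `<< mu.
  move=> A A0 B mB BA.
  apply/eqP; rewrite eq_le measure_ge0 andbT.
  rewrite (le_trans (nu0_le _))// -(A0 _ mB BA) /= le_measure ?inE//.
  exact: measurableI.
have [h [h0 hfin hint hE]] := radon_nikodym_sigma_finite nu_mu.
pose f := fine \o h.
have fE : EFin \o f = h by apply/funext => x; rewrite /f /= fineK.
have fint A : measurable (A : set (measurableTypeR R)) -> mu.-integrable A (EFin \o f).
  by move=> mA; rewrite fE; exact: integrableS hint.
have floc : locally_integrable setT f.
  by have := integrable_locally measurableT (fint _ measurableT); rewrite patch_setT.
have fint' y : mu.-integrable [set` Interval (BRight a) (BRight y)] (EFin \o f).
  by apply: fint; exact: measurable_itv.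
have := FTC1 fint' floc.
apply: filterS; first exact: (ae_filter_ringOfSetsType mu).
move=> x /= Hx /andP[ax xb].
have {Hx}[dF _] : derivable (fun x0 => \int[mu]_(t in `]a, x0]) f t) x 1 /\ _ := Hx ax.
(* Near [x], [G] is the integral of the density plus the constant [G a], so it inherits the
   derivative given by the fundamental theorem of calculus. *)
suff : {near x, (fun x0 => (\int[mu]_(t in `]a, x0]) f t) + G a) =1 G}.
  by move/near_eq_derivable; apply; apply: derivableD.
near=> y.
have ay : a < y by near: y; exact: lt_nbhsr.
have yb : y < b by near: y; exact: lt_nbhsl.
rewrite /Rintegral.
under eq_integral do rewrite -[(f _)%:E]/((EFin \o f) _) fE.
rewrite -hE; last exact: measurable_itv.
rewrite /nu/= /mfrestr /mrestr /= setIidl; last first.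
  by move=> z /=; rewrite !in_itv/= => /andP[-> /le_trans]; apply; exact: ltW.
have -> : lebesgue_stieltjes_measure Gc `]a, y]%classic = (G y - G a)%:E.
  rewrite -(wlength_itv_bnd G false false (ltW ay)) -(measurable_mu_extE (wlength Gc))//.
  exact: is_ocitv.
by rewrite /= subrK.
Unshelve. all: by end_near. Qed.

(** Adding the identity to [f / K1] gives a nondecreasing function, and halving makes it
    1-Lipschitz. The monotone case applies to this [G], and [f] is recovered as
    [K1 * (2 * G x - x)]. *)
Lemma lipschitz_ae_derivable (f : R -> R) (a b K : R) :
  (forall x y, a <= x <= b -> a <= y <= b -> `|f x - f y| <= K * `|x - y|) ->
  {ae mu, forall t, a < t < b -> derivable f t 1}.
Proof.
move=> fK; have [ba|ab] := leP b a.
  by apply/aeW => t /andP[at_ tb]; move: (lt_trans at_ tb); rewrite ltNge ba.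
pose K1 := `|K| + 1.
have K10 : 0 < K1 by rewrite ltr_wpDl.
have {}fK x y : a <= x <= b -> a <= y <= b -> `|f x - f y| <= K1 * `|x - y|.
  move=> hx hy; apply: (le_trans (fK x y hx hy)); apply: ler_wpM2r => //.
  by rewrite (le_trans (ler_norm _))// lerDl.
pose c := clamp a b.
have cab x : a <= c x <= b by apply: clamp_itv; exact: ltW.
have cnd x y : x <= y -> 0 <= c y - c x <= y - x by apply: clamp_homo; exact: ltW.
pose G x := (f (c x) / K1 + c x) / 2.
have GP x y : x <= y -> 0 <= G y - G x <= y - x.
  move=> xy; have /andP[h1 h2] := cnd _ _ xy.
  have := fK (c y) (c x) (cab y) (cab x); rewrite (ger0_norm h1).
  rewrite mulrC -ler_pdivrMr// -{1}(ger0_norm (ltW K10)) -normfV -normrM mulrBl ler_norml /G.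
  by move=> /andP[h3 h4]; apply/andP; split; lra.
have := monotone_lipschitz_ae_derivable a b GP.
apply: filterS; first exact: (ae_filter_ringOfSetsType mu).
move=> t /= + tab; move=> /(_ tab) dG.
suff : {near t, (fun x => K1 *: ((2 : R) *: G x - x)) =1 f}.
  move/near_eq_derivable; apply; apply: derivableZ; apply: derivableB => //.
  exact: derivableZ.
move: tab => /andP[at_ tb]; near=> x.
have ax : a < x by near: x; exact: lt_nbhsr.
have xb : x < b by near: x; exact: lt_nbhsl.
rewrite /G /c clamp_id ?(ltW ax) ?(ltW xb)// /GRing.scale /=; field.
by rewrite gt_eqF.
Unshelve. all: by end_near. Qed.

End LipschitzDifferentiability.

(** * Picard's theorem *)

Section Picard.
Context {R : realType}.
Notation mu := (@lebesgue_measure R).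

Lemma antiderivative (f : R -> R) (a : R) : continuous f ->
  exists F, forall t, a < t -> has_deriv F t (f t).
Proof.
move=> cf; exists (fun x => \int[mu]_(t in `[a, x]) f t) => t at_.
have tt1 : t < t + 1 by rewrite ltrDl.
have fi : mu.-integrable `[a, t + 1] (EFin \o f).
  apply: continuous_compact_integrable; first exact: segment_compact.
  exact: continuous_subspaceT.
have [dF F'] := continuous_FTC1_closed tt1 fi at_ (cf t).
by apply/has_derivP; split => //; rewrite -derive1E F'.
Qed.

(** The integrals start at -1, so that the derivative at 0 is two-sided. *)
Lemma matrix_antiderivative (p q : nat) (f : R -> 'M[R]_(p, q)) (c : 'M[R]_(p, q)) :
  continuous f ->
  exists2 F, F 0 = c & forall t, -1 < t -> has_deriv F t (f t).
Proof.
move=> cf.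
have /choice[F dF] : forall ij : 'I_p * 'I_q, exists F, forall t, -1 < t ->
    has_deriv F t (f t ij.1 ij.2).
  move=> [i j]; apply: antiderivative => t.
  exact: (@continuous_comp _ _ _ f (fun M => M i j) t (cf t) (@coord_continuous _ _ _ i j (f t))).
pose G t := \matrix_(i, j) (F (i, j) t - F (i, j) 0).
exists (fun t => c + G t); first by apply/matrixP => i j; rewrite !mxE subrr addr0.
move=> t t1; rewrite -[f t]add0r; apply: has_derivD; first exact: has_deriv_cst.
have dG i j : has_deriv (fun t => G t i j) t (f t i j).
  rewrite -[f t i j]subr0; under [X in has_deriv X]eq_fun do rewrite mxE.
  by apply: has_derivB; [exact: (dF (i, j))|exact: has_deriv_cst].
have dmx : derivable G t 1.
  by apply/derivable_mxP => i j; have /has_derivP[] := dG i j.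
apply/has_derivP; split => //; rewrite derive_mx//.
by apply/matrixP => i j; rewrite mxE; have /has_derivP[] := dG i j.
Qed.

Lemma geometric_small (D e : R) : 0 < e -> exists i, D / 2 ^+ i < e.
Proof.
move=> e0; have : (D * 2^-1 ^+ i) @[i --> \oo] --> (D * 0 : R).
  by apply: cvgMr; apply: cvg_expr; rewrite ger0_norm ?invr_ge0// invf_lt1// ltr1n.
rewrite mulr0 => /cvgrPdist_lt/(_ e e0)[N _ /(_ N (leqnn _))] /=.
by rewrite sub0r normrN exprVn => /(le_lt_trans (ler_norm _)); exists N.
Qed.

(** The quantities [D * 2 / 2 ^+ i] have successive differences [D / 2 ^+ i]; telescoping gives the
    Cauchy property with an explicit rate. *)
Lemma geometric_cvg (m n : nat) (u : nat -> 'M[R]_(m, n)) (D : R) :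
  (forall i, `|u i.+1 - u i| <= D / 2 ^+ i) ->
  exists l, forall i, `|l - u i| <= D * 2 / 2 ^+ i.
Proof.
move=> uD.
have D0 : 0 <= D by have := uD 0%N; rewrite expr0 divr1; exact: le_trans.
have udist i j : `|u (i + j)%N - u i| <= D * 2 / 2 ^+ i - D * 2 / 2 ^+ (i + j).
  elim: j => [|j IH]; first by rewrite addn0 !subrr normr0.
  rewrite addnS -(subrKA (u (i + j)%N)) (le_trans (ler_normD _ _))//.
  have := uD (i + j)%N; rewrite exprS.
  have -> : D * 2 / (2 * 2 ^+ (i + j)) = D / 2 ^+ (i + j).
    by rewrite invfM mulrA mulfK// pnatr_eq0.
  have E : D * 2 / 2 ^+ (i + j) = D / 2 ^+ (i + j) * 2 by rewrite mulrAC.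
  rewrite E in IH; move: (D / 2 ^+ (i + j)) (D * 2 / 2 ^+ i) IH => p q.
  by move=> ? ?; lra.
have udist' i j : (i <= j)%N -> `|u j - u i| <= D * 2 / 2 ^+ i.
  move=> ij; have := udist i (j - i)%N; rewrite subnKC// => /le_trans; apply.
  by rewrite gerBl divr_ge0 ?mulr_ge0// exprn_ge0.
have tail := geometric_small (D * 2).
have cu : cvg (u i @[i --> \oo]).
  apply: cauchy_cvg; apply: cauchy_exP => e e0.
  have [N HN] := tail e e0; exists (u N); exists N => // i /= Ni.
  by rewrite -ball_normE /= distrC (le_lt_trans (udist' _ _ Ni)).
exists (lim (u i @[i --> \oo])) => i.
apply/ler_addgt0Pr => e e0.
have /cvgrPdist_lt/(_ e e0)[N _ HN] := cu.
have := HN (N + i)%N (leq_addr _ _) => /= h.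
rewrite -(subrKA (u (N + i)%N)) (le_trans (ler_normD _ _))// addrC lerD ?(ltW h)//.
exact/udist'/leq_addl.
Qed.

Context (p q : nat) (phi : R -> 'M[R]_(p, q) -> 'M[R]_(p, q)) (L h : R) (c : 'M[R]_(p, q)).
Hypotheses (h0 : 0 < h) (L0 : 0 <= L) (Lh : L * h <= 1 / 2).
Hypothesis phi_cont : forall x, continuous (phi^~ x).
Hypothesis phi_lip : forall t x x', `|phi t x - phi t x'| <= L * `|x - x'|.

Lemma lipschitz_field_continuous (X : R -> 'M[R]_(p, q)) : continuous X ->
  continuous (fun t => phi t (X t)).
Proof.
move=> cX t; suff : phi s (X s) @[s --> t] --> phi t (X t) by [].
apply/cvgrPdist_le => e e0.
pose e1 := e / (2 * (L + 1)).
have L1 : 0 < 2 * (L + 1) by rewrite mulr_gt0// ltr_wpDl.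
have e10 : 0 < e1 by rewrite divr_gt0.
have e2 : e = e1 * (2 * (L + 1)) by rewrite mulfVK// gt_eqF.
have ct : phi s (X t) @[s --> t] --> phi t (X t) by exact: phi_cont.
have H1 : \forall s \near t, `|phi t (X t) - phi s (X t)| <= e / 2.
  by move/cvgrPdist_le: ct; apply; rewrite divr_gt0.
have H2 : \forall s \near t, `|X t - X s| <= e1.
  by have /cvgrPdist_le := cX t; exact.
near=> s.
have h1 : `|phi t (X t) - phi s (X t)| <= e / 2.
  by near: s; exact: H1.
have h2 : `|X t - X s| <= e1.
  by near: s; exact: H2.
rewrite -(subrKA (phi s (X t))) (le_trans (ler_normD _ _))//.
rewrite [leRHS]splitr lerD// (le_trans (phi_lip _ _ _))//.
rewrite (le_trans (ler_wpM2l L0 h2))// e2; nra.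
Unshelve. all: by end_near. Qed.

(* The vector field is frozen outside [0, h] so that every iterate extends
   continuously to the whole line. *)
Theorem picard : exists2 Y, Y 0 = c &
  forall t, 0 <= t <= h -> has_deriv Y t (phi t (Y t)).
Proof.
have h0' := ltW h0.
pose cont (X : R -> 'M[R]_(p, q)) := forall t, 0 <= t <= h -> {for t, continuous X}.
(* [F] is the Picard operator, made total by an arbitrary value on functions not continuous on
   [0, h]. *)
have /choice[F HF] : forall X, exists Y, cont X ->
    Y 0 = c /\ forall t, -1 < t -> has_deriv Y t (phi t (X (clamp 0 h t))).
  move=> X; have [cX|ncX] := pselect (cont X); last by exists X.
  have cXc : continuous (X \o clamp 0 h).
    by move=> t; apply: continuous_comp; [exact: clamp_continuous|exact/cX/clamp_itv].
  have [Y Y0 dY] := matrix_antiderivative c (lipschitz_field_continuous cXc).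
  by exists Y.
have Fcont X : cont X -> cont (F X).
  move=> /HF[_ dF] t /andP[t0 th]; apply: has_deriv_continuous (dF t _); lra.
(* As [L * h <= 1 / 2], the operator halves uniform distances on [0, h]. *)
have Fcontr X X' (d : R) : cont X -> cont X' ->
    (forall t, 0 <= t <= h -> `|X t - X' t| <= d) ->
    forall t, 0 <= t <= h -> `|F X t - F X' t| <= d / 2.
  move=> /HF[F0 dF] /HF[F0' dF'] Xd t /andP[t0 th].
  have d0 : 0 <= d by apply: le_trans (Xd 0 _); rewrite ?lexx ?h0'.
  have := @mean_value_ineq R _ (fun s => F X s - F X' s)
    (fun s => phi s (X (clamp 0 h s)) - phi s (X' (clamp 0 h s))) 0 t (L * d) t0.
  rewrite F0 F0' !subrr !subr0 => H; apply: le_trans (H _ _) _.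
  - by move=> s /andP[s0 st]; apply: has_derivB; [apply: dF|apply: dF']; lra.
  - move=> s _; apply: le_trans (phi_lip _ _ _) _; apply: ler_wpM2l => //.
    exact/Xd/clamp_itv.
  - have : L * t <= 1 / 2 by apply: le_trans Lh; exact: ler_wpM2l.
    nra.
pose X i := iter i F (fun=> c).
have cX i : cont (X i).
  by elim: i => [|i IH]; [move=> t _; exact: cst_continuous|exact: Fcont].
have [K HK] : exists K, forall t, 0 <= t <= h -> `|X 1%N t - X 0%N t| <= K.
  apply: continuous_itv_bounded => // t ht.
  by apply: continuousB; exact: cX.
have XD i t : 0 <= t <= h -> `|X i.+1 t - X i t| <= K / 2 ^+ i.
  elim: i t => [t|i IH t] ht; first by rewrite expr0 divr1; exact: HK.
  rewrite exprSr invfM mulrA.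
  exact: (Fcontr (X i.+1) (X i)).
have /choice[Z HZ] : forall t, exists l, 0 <= t <= h ->
    forall i, `|l - X i t| <= K * 2 / 2 ^+ i.
  move=> t; have [ht|nht] := boolP (0 <= t <= h); last by exists 0.
  by have [l Hl] := @geometric_cvg p q (fun i => X i t) K (fun i => XD i t ht); exists l.
have cZ : continuous (Z \o clamp 0 h).
  move=> t; apply/cvgrPdist_le => e e0.
  have [i Hi] := geometric_small (K * 2) (divr_gt0 e0 (ltr0n _ 3)).
  have cXi : {for t, continuous (X i \o clamp 0 h)}.
    by apply: continuous_comp; [exact: clamp_continuous|exact/cX/clamp_itv].
  have H3 : \forall s \near t, `|X i (clamp 0 h t) - X i (clamp 0 h s)| <= e / 3.
    by move/cvgrPdist_le: cXi; apply; rewrite divr_gt0.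
  near=> s => /=.
  have h1 := HZ _ (clamp_itv t h0') i; have h2 := HZ _ (clamp_itv s h0') i.
  have h3 : `|X i (clamp 0 h t) - X i (clamp 0 h s)| <= e / 3.
    by near: s; exact: H3.
  rewrite distrC in h2.
  rewrite -(subrKA (X i (clamp 0 h t))) (le_trans (ler_normD _ _))//.
  rewrite -(subrKA (X i (clamp 0 h s)) (X i (clamp 0 h t))).
  have := ler_normD (X i (clamp 0 h t) - X i (clamp 0 h s)) (X i (clamp 0 h s) - Z (clamp 0 h s)).
  lra.
have cZ' : cont (Z \o clamp 0 h) by move=> t _; exact: cZ.
have [Y0 dY] := HF _ cZ'.
(* The limit [Z] is determined on [0, h] only; its image under [F] agrees with it there and is
   differentiable at the end points too. *)
exists (F (Z \o clamp 0 h)) => // t ht.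
suff YZ : F (Z \o clamp 0 h) t = Z t.
  rewrite YZ; have := dY t; rewrite /= (clamp_id ht) (clamp_id ht); apply.
  by case/andP: ht => ? _; lra.
apply/eqP; rewrite -subr_eq0 -normr_le0; apply/ler_addgt0Pr => e e0; rewrite add0r.
have [i Hi] := geometric_small (K * 2) e0.
have h1 : `|F (Z \o clamp 0 h) t - X i.+1 t| <= K * 2 / 2 ^+ i / 2.
  apply: (Fcontr _ (X i) _ cZ' (cX i)) => // s hs /=.
  by rewrite clamp_id//; exact: HZ.
have h2 := HZ _ ht i.+1; rewrite distrC exprSr invfM mulrA in h2.
rewrite -(subrKA (X i.+1 t)) (le_trans (ler_normD _ _))//; lra.
Unshelve. all: by end_near. Qed.

End Picard.

(** * Controllability by piecewise constant controls *)

Section MatrixNorm.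
Context {R : realType}.

Lemma mx_norm_leP (p q : nat) (M : 'M[R]_(p, q)) (e : R) : 0 <= e ->
  (`|M| <= e) <-> (forall i j, `|M i j| <= e).
Proof.
move=> e0; rewrite {1}/Num.Def.normr /= mx_normrE; split.
  by move=> h i j; apply: le_trans h; exact: (le_bigmax _ _ (i, j)).
by move=> h; apply: bigmax_le => // -[i j] _; exact: h.
Qed.

Lemma mx_norm_entry (p q : nat) (M : 'M[R]_(p, q)) i j : `|M i j| <= `|M|.
Proof. by apply: (mx_norm_leP M (normr_ge0 _)).1. Qed.

(** The norm is the maximum of the entries, so the inner dimension [q] appears as a factor. *)
Lemma mx_norm_mulmx (p q r : nat) (M : 'M[R]_(p, q)) (N : 'M[R]_(q, r)) :
  `|M *m N| <= q%:R * `|M| * `|N|.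
Proof.
apply/mx_norm_leP => [|i j]; first by rewrite !mulr_ge0.
rewrite mxE (le_trans (ler_norm_sum _ _ _))//.
have -> : q%:R * `|M| * `|N| = \sum_(l < q) `|M| * `|N|.
  by rewrite sumr_const card_ord -mulrA mulr_natl.
by apply: ler_sum => l _; rewrite normrM ler_pM// mx_norm_entry.
Qed.

Lemma has_deriv_mulmxr (p q r : nat) (F : R -> 'M[R]_(p, q)) (v : 'M[R]_(q, r)) t l :
  has_deriv F t l -> has_deriv (fun s => F s *m v) t (l *m v).
Proof.
move=> Fl e e0.
pose e1 := e / (q%:R * `|v| + 1).
have qv : 0 < q%:R * `|v| + 1 by rewrite ltr_wpDl// mulr_ge0.
have [d d0 H] := Fl e1 (divr_gt0 e0 qv); exists d => // s sd.
rewrite scalemxAl -!mulmxBl (le_trans (mx_norm_mulmx _ _))//.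
have := H s sd; set M := F s - F t - _ => HM.
apply: (@le_trans _ _ ((q%:R * `|v|) * (e1 * `|s - t|))).
  by rewrite mulrAC ler_wpM2l// mulr_ge0.
rewrite mulrA ler_wpM2r// /e1 mulrCA ler_piMr ?(ltW e0)// ler_pdivrMr// mul1r.
by rewrite lerDl.
Qed.

End MatrixNorm.

(** * The Kalman condition for sampled systems *)

Section Kalman.
Context {R : realType} {m k : nat}.
Implicit Types (A D F : 'M[R]_m) (B P G : 'M[R]_(m, k)).

(** Induction moves one factor [A] onto the row vector. Ranks of Kalman matrices are compared below
    through left kernels, block by block. *)
Lemma mul_ctrb_eq0 A B l (xi : 'rV[R]_m) : xi *m ctrb A B l = 0 <->
  forall i, (i < l)%N -> xi *m iter i (mulmx A) B = 0.
Proof.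
elim: l xi => [|l IH] xi /=; first by split=> // _; apply/matrixP => i [].
rewrite mul_mx_row mulmxA; split.
  move/eqP; rewrite row_mx_eq0 => /andP[/eqP xB /eqP /IH xA] [|i] //=.
  by rewrite ltnS mulmxA; exact: xA.
move=> h; apply/eqP; rewrite row_mx_eq0; apply/andP; split; apply/eqP.
  exact: (h 0%N).
by apply/IH => i il; have := h i.+1 il; rewrite /= mulmxA.
Qed.

(* [F] plays the role of the flow [exp(hA)] and [G] of the response to a
   constant control over a time [h]; their difference quotients approximate
   [A] and [B]. *)
Lemma difference_quotient_ker F G (h : R) i (xi : 'rV[R]_m) :
  (forall j, (j <= i)%N -> xi *m iter j (mulmx F) G = 0) ->
  xi *m iter i (mulmx (h^-1 *: (F - 1%:M))) (h^-1 *: G) = 0.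
Proof.
elim: i xi => [|i IH] xi H /=.
  by rewrite -scalemxAr (H 0%N)// scaler0.
(* The induction passes to the row vector [xi *m (h^-1 *: (F - 1%:M))]: applied to [F^j G], it gives
   a multiple of the difference of two terms that vanish. *)
rewrite mulmxA; apply: IH => j ji.
rewrite -scalemxAr -scalemxAl mulmxBr mulmx1 mulmxBl -mulmxA.
by rewrite (H j.+1)// (H j) ?subr0 ?scaler0// (leq_trans ji).
Qed.

(** The Kalman matrix is polynomial in its data, hence continuous; the induction uses
    [D C' - A C = D (C' - C) + (D - A) C]. *)
Lemma ctrb_near A B l (e : R) : 0 < e -> exists2 d : R, 0 < d &
  forall D P, `|D - A| <= d -> `|P - B| <= d -> `|ctrb D P l - ctrb A B l| <= e.
Proof.
elim: l e => [|l IH] e e0; first by exists 1 => // D P _ _; rewrite subrr normr0 ltW.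
pose C := ctrb A B l.
pose e1 := e / (m%:R * (`|A| + 1 + `|C|) + 1).
have den : 0 < m%:R * (`|A| + 1 + `|C|) + 1 by rewrite ltr_wpDl// mulr_ge0// !addr_ge0.
have e10 : 0 < e1 by rewrite divr_gt0.
have [d d0 Hd] := IH e1 e10.
exists (Num.min (Num.min 1 d) (Num.min e1 e)); first by rewrite !lt_min ltr01 d0 e10.
move=> D P; rewrite !le_min => /andP[/andP[D1 Dd] /andP[De1 _]] /andP[/andP[_ Pd] /andP[_ Pe]].
rewrite /= opp_row_mx add_row_mx -/C.
have {}Hd := Hd D P Dd Pd; set C' := ctrb D P l in Hd *.
have DA : `|D| <= `|A| + 1.
  by rewrite -(subrK A D) (le_trans (ler_normD _ _))// addrC lerD2l.
have HC : `|D *m C' - A *m C| <= e.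
  have -> : D *m C' - A *m C = D *m (C' - C) + (D - A) *m C.
    by rewrite mulmxBr mulmxBl addrA subrK.
  rewrite (le_trans (ler_normD _ _))//.
  have h1 := mx_norm_mulmx D (C' - C); have h2 := mx_norm_mulmx (D - A) C.
  have h3 : m%:R * `|D| * `|C' - C| <= m%:R * (`|A| + 1) * e1.
    by rewrite ler_pM ?mulr_ge0// ler_wpM2l.
  have h4 : m%:R * `|D - A| * `|C| <= m%:R * `|C| * e1.
    by rewrite mulrAC ler_wpM2l// mulr_ge0.
  have -> : e = e1 * (m%:R * (`|A| + 1 + `|C|) + 1) by rewrite mulfVK// gt_eqF.
  lra.
apply/mx_norm_leP => [|i j]; first exact: ltW.
by rewrite mxE; case: (fintype.split _) => j'; rewrite (le_trans (mx_norm_entry _ _ _)).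
Qed.

Lemma row_free_ker (p q : nat) (C : 'M[R]_(p, q)) :
  (forall xi : 'rV[R]_p, xi *m C = 0 -> xi = 0) -> row_free C.
Proof.
move=> H; rewrite -kermx_eq0; apply/eqP/row_matrixP => i.
by rewrite row0; apply: H; rewrite -row_mul mulmx_ker row0.
Qed.

(** If [Q] is a right inverse of [C], a row vector killed by [C'] equals its own product with
    [(C - C') Q], so its norm is at most half of itself. *)
Lemma row_free_near (p q : nat) (C : 'M[R]_(p, q)) : row_free C ->
  exists2 d : R, 0 < d & forall C' : 'M[R]_(p, q), `|C' - C| <= d -> row_free C'.
Proof.
move=> /row_freeP[Q CQ].
pose N := p%:R * (q%:R * `|Q|) + 1.
have N0 : 0 < N by rewrite ltr_wpDl// !mulr_ge0.
exists (N^-1 / 2); first by rewrite divr_gt0// invr_gt0.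
move=> C' C'C; apply: row_free_ker => xi xiC'.
have xiE : xi = xi *m ((C - C') *m Q).
  by rewrite mulmxBl mulmxBr CQ mulmx1 mulmxA xiC' mul0mx subr0.
have h1 := mx_norm_mulmx (C - C') Q; rewrite (distrC C) in h1.
have h2 : `|xi| <= `|xi| / 2.
  rewrite {1}xiE (le_trans (mx_norm_mulmx _ _))//.
  rewrite (mulrC p%:R) -mulrA ler_wpM2l//.
  rewrite (le_trans (ler_wpM2l _ h1))//.
  apply: (@le_trans _ _ (p%:R * (q%:R * `|Q|) * (N^-1 / 2))).
    rewrite -!mulrA ler_wpM2l// ler_wpM2l// mulrC ler_wpM2l//.
  rewrite (mulrA _ N^-1) -[leRHS]mul1r ler_wpM2r// ?invr_ge0// ler_pdivrMr// mul1r.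
  by rewrite lerDl.
by apply/eqP; rewrite -normr_le0; have := normr_ge0 xi; lra.
Qed.

(** Reachability in [l] steps for the discrete-time system [x -> F x + G u], which is the control
    system sampled under piecewise constant controls. *)
Fixpoint steers F G (l : nat) (x y : 'cV[R]_m) : Prop :=
  match l with
  | 0 => y = x
  | l'.+1 => exists x' u, steers F G l' x x' /\ y = F *m x' + G *m u
  end.

(** The blocks of [U] are the controls in reverse order: the top block acts last. *)
Lemma steers_ctrb F G l x (U : 'cV[R]_(l * k)) :
  steers F G l x (iter l (mulmx F) x + ctrb F G l *m U).
Proof.
elim: l U => [|l IH] U; first by rewrite /= mul0mx addr0.
rewrite -[U](@vsubmxK _ k (l * k)); exists (iter l (mulmx F) x + ctrb F G l *m dsubmx U), (usubmx U).
split; first exact: IH.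
by rewrite mul_row_col mulmxDr mulmxA -addrA [X in _ + X]addrC.
Qed.

Lemma row_free_steers F G l x y : row_free (ctrb F G l) -> steers F G l x y.
Proof.
move=> /row_freeP[Q CQ].
have := steers_ctrb F G x (Q *m (y - iter l (mulmx F) x)).
by rewrite mulmxA CQ mul1mx addrC subrK.
Qed.

(** A row vector killing the sampled Kalman matrix also kills that of the difference quotients of
    [Phi] and [Psi], which for small [h] is close to [ctrb A B m] and so has full row rank. *)
Lemma small_time_controllable A B (Phi : R -> 'M[R]_m) (Psi : R -> 'M[R]_(m, k)) :
  row_free (ctrb A B m) -> Phi 0 = 1%:M -> Psi 0 = 0 ->
  has_deriv Phi 0 A -> has_deriv Psi 0 B ->
  exists2 d : R, 0 < d & forall h, 0 < h < d ->
    forall x y, steers (Phi h) (Psi h) m x y.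
Proof.
move=> free Phi0 Psi0 dPhi dPsi.
have [e e0 He] := row_free_near free.
have [d d0 Hd] := ctrb_near A B m e0.
have [d1 d10 H1] := dPhi d d0; have [d2 d20 H2] := dPsi d d0.
exists (Num.min d1 d2); first by rewrite lt_min d10.
move=> h; rewrite lt_min => /andP[h0 /andP[hd1 hd2]] x y.
have hn : `|h - 0| = h by rewrite subr0 gtr0_norm.
apply: row_free_steers; apply: row_free_ker => xi /mul_ctrb_eq0 xi0.
have scl p (M N : 'M[R]_(m, p)) : `|M - h *: N| <= d * h -> `|h^-1 *: M - N| <= d.
  move=> hMN; rewrite -[N](scalerK (negbT (gt_eqF h0))) -scalerBr normrZ normfV.
  by rewrite gtr0_norm// ler_pdivrMl// mulrC.
have freeh : row_free (ctrb (h^-1 *: (Phi h - 1%:M)) (h^-1 *: Psi h) m).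
  apply/He/Hd; apply: scl.
    by have := H1 h; rewrite hn Phi0 subr0; exact.
  by have := H2 h; rewrite hn Psi0 !subr0; exact.
apply/eqP; rewrite -(mulmx_free_eq0 xi freeh); apply/eqP.
apply/mul_ctrb_eq0 => i im; apply: difference_quotient_ker => j ji.
by apply: xi0; exact: leq_ltn_trans im.
Qed.

(** [Phi] is [exp(tA)] and [Psi] the integral of [exp(sA) B] over [0, t], both obtained from
    Picard's theorem on a short interval. *)
Lemma linear_flow A B : exists2 h0 : R, 0 < h0 &
  exists (Phi : R -> 'M[R]_m) (Psi : R -> 'M[R]_(m, k)),
  [/\ Phi 0 = 1%:M, Psi 0 = 0,
    forall t, 0 <= t <= h0 -> has_deriv Phi t (A *m Phi t) &
    forall t, 0 <= t <= h0 -> has_deriv Psi t (A *m Psi t + B)].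
Proof.
pose L := m%:R * `|A|; have L0 : 0 <= L by rewrite mulr_ge0.
have L1 : 0 < 2 * (L + 1) by rewrite mulr_gt0// ltr_wpDl.
have h0 : 0 < (2 * (L + 1))^-1 by rewrite invr_gt0.
exists (2 * (L + 1))^-1 => //.
have Lh : L * (2 * (L + 1))^-1 <= 1 / 2.
  by rewrite ler_pdivrMr//; lra.
have [||Phi Phi0 dPhi] := @picard R m m (fun _ X => A *m X) L _ 1%:M h0 L0 Lh.
- by move=> x; exact: cst_continuous.
- by move=> _ x x'; rewrite -mulmxBr mx_norm_mulmx.
have [||Psi Psi0 dPsi] := @picard R m k (fun _ X => A *m X + B) L _ 0 h0 L0 Lh.
- by move=> x; exact: cst_continuous.
- by move=> _ x x'; rewrite opprD addrACA subrr addr0 -mulmxBr mx_norm_mulmx.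
by exists Phi, Psi.
Qed.

End Kalman.

(** * Trajectories *)

Section Gluing.
Context {R : realType}.

Definition glue (X : Type) (c : R) (f f' : R -> X) (t : R) := if t <= c then f t else f' t.

Lemma glue_left (X : Type) c (f f' : R -> X) t : t <= c -> glue c f f' t = f t.
Proof. by rewrite /glue => ->. Qed.

Lemma glue_right (X : Type) c (f f' : R -> X) t : f c = f' c -> c <= t ->
  glue c f f' t = f' t.
Proof.
by rewrite /glue => ff' ct; case: ifP => // tc; rewrite (@le_anti _ _ t c) ?tc ?ct.
Qed.

Definition lip_on (V : normedModType R) (K a b : R) (f : R -> V) :=
  forall s t, a <= s -> s <= t -> t <= b -> `|f t - f s| <= K * (t - s).

Lemma lip_onW (V : normedModType R) (K K' a b : R) (f : R -> V) : K <= K' ->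
  lip_on K a b f -> lip_on K' a b f.
Proof.
move=> KK' fK s t as_ st tb; apply: le_trans (fK s t as_ st tb) _.
by rewrite ler_wpM2r// subr_ge0.
Qed.

Lemma lip_on_glue (V : normedModType R) (K a c b : R) (f f' : R -> V) :
  f c = f' c -> lip_on K a c f -> lip_on K c b f' -> lip_on K a b (glue c f f').
Proof.
move=> ff' fK fK' s t as_ st tb.
have [tc|/ltW ct] := leP t c.
  by rewrite !glue_left ?(le_trans st tc)//; exact: fK.
have [sc|/ltW cs] := leP s c; last by rewrite !glue_right//; exact: fK'.
rewrite (glue_left _ _ sc) (glue_right ff' ct) -(subrKA (f' c)).
rewrite (le_trans (ler_normD _ _))// (_ : t - s = (t - c) + (c - s)); last by ring.
by rewrite mulrDr lerD//; [exact: fK'|rewrite -ff'; exact: fK].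
Qed.

Lemma has_deriv_glue_left (V : normedModType R) c (f f' : R -> V) t l :
  t < c -> has_deriv f t l -> has_deriv (glue c f f') t l.
Proof.
move=> tc; apply: (@has_deriv_eq_near _ _ _ _ _ _ (c - t)); rewrite ?subr_gt0//.
by move=> s; rewrite ltr_distl => /andP[_ sc]; rewrite glue_left//; lra.
Qed.

Lemma has_deriv_glue_right (V : normedModType R) c (f f' : R -> V) t l :
  c < t -> has_deriv f' t l -> has_deriv (glue c f f') t l.
Proof.
move=> ct; apply: (@has_deriv_eq_near _ _ _ _ _ _ (t - c)); rewrite ?subr_gt0//.
move=> s; rewrite ltr_distl => /andP[sc _]; rewrite /glue ifF//.
by apply/negbTE; rewrite -ltNge; lra.
Qed.

End Gluing.

Lemma lipschitz_continuous {R : realType} (V W : normedModType R) (f : V -> W) (K : R) :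
  0 <= K -> (forall x x', `|f x - f x'| <= K * `|x - x'|) -> continuous f.
Proof.
move=> K0 fK x; apply/cvgrPdist_le => e e0.
have K1 : 0 < K + 1 by rewrite ltr_wpDl.
near=> y; apply: le_trans (fK x y) _.
have h : `|x - y| <= e / (K + 1).
  by near: y; apply: cvgr_dist_le; [exact: cvg_id|rewrite divr_gt0].
apply: le_trans (ler_wpM2l K0 h) _.
by rewrite mulrCA ler_piMr ?(ltW e0)// ler_pdivrMr// mul1r lerDl.
Unshelve. all: by end_near. Qed.

(** * Chattering trajectories *)

Section Trajectories.
Context {R : realType} {m k n : nat}.
Context (A : 'M[R]_m) (B : 'M[R]_(m, k)) (g : 'cV[R]_k -> 'cV[R]_m -> 'cV[R]_n -> 'cV[R]_n).
Context (M L : R).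
Hypothesis free : row_free (ctrb A B m).
Hypothesis gM : forall u y z, `|g u y z| <= M.
Hypothesis L0 : 0 <= L.
Hypothesis gL : forall u y1 z1 y2 z2,
  `|g u y1 z1 - g u y2 z2| <= L * (`|y1 - y2| + `|z1 - z2|).
Implicit Types (x y : 'cV[R]_m) (w z : 'cV[R]_n) (u : 'cV[R]_k).

Let M0 : 0 <= M. Proof. exact: le_trans (normr_ge0 _) (gM 0 0 0). Qed.

(** A strong form of solution, suited to piecewise constant controls: the equations hold off a
    finite set. The Lipschitz constant of [y] is left free, since steering may take large controls,
    while that of [w] is always [M]. *)
Definition traj (a b : R) (u : R -> 'cV[R]_k) (y : R -> 'cV[R]_m) (w : R -> 'cV[R]_n) :=
  [/\ a <= b,
      forall O : set 'cV[R]_k, measurable (`[a, b]%classic `&` u @^-1` O),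
      exists K, lip_on K a b y,
      lip_on M a b w &
      exists F : seq R, forall t, a < t < b -> t \notin F ->
        has_deriv y t (A *m y t + B *m u t) /\ has_deriv w t (g (u t) (y t) (w t))].

Lemma traj_glue a c b (u u' : R -> 'cV[R]_k) (y y' : R -> 'cV[R]_m)
    (w w' : R -> 'cV[R]_n) : traj a c u y w -> traj c b u' y' w' ->
  y c = y' c -> w c = w' c ->
  traj a b (glue c u u') (glue c y y') (glue c w w').
Proof.
move=> [ac mu_ [K yK] wM [F dF]] [cb mu' [K' yK'] wM' [F' dF']] yy ww; split.
- exact: le_trans cb.
- move=> O.
  have -> : `[a, b]%classic `&` glue c u u' @^-1` O =
      (`[a, c]%classic `&` u @^-1` O) `|` (`]c, b]%classic `&` (`[c, b]%classic `&` u' @^-1` O)).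
    apply/seteqP; split => t /=; rewrite !in_itv /= /glue.
      have [tc|ct] := leP t c => -[/andP[at_ tb] Ot].
        by left; rewrite at_.
      by right; rewrite tb (ltW ct).
    move=> [[/andP[at_ tc] Ot]|[/andP[ct tb] [_ Ot]]].
      by rewrite at_ (le_trans tc cb) tc.
    by rewrite (le_trans ac (ltW ct)) tb leNgt ct.
  by apply: measurableU => //; apply: measurableI => //; exact: measurable_itv.
- exists (Num.max K K'); apply: lip_on_glue => //.
    by apply: lip_onW yK; rewrite le_max lexx.
  by apply: lip_onW yK'; rewrite le_max lexx orbT.
- exact: lip_on_glue.
- exists (c :: F ++ F') => t /andP[at_ tb].
  rewrite inE mem_cat !negb_or => /and3P[tc tF tF'].
  have [tltc|ctlt|tec] := ltgtP t c; last by rewrite tec eqxx in tc.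
    have [|d1 d2] := dF t _ tF; first by rewrite at_.
    by rewrite !(glue_left _ _ (ltW tltc)); split; exact: has_deriv_glue_left.
  have [|d1 d2] := dF' t _ tF'; first by rewrite ctlt.
  have -> : glue c u u' t = u' t by rewrite /glue leNgt ctlt.
  by rewrite !glue_right ?ltW//; split; exact: has_deriv_glue_right.
Qed.

(** The system is autonomous; allowing every starting time [a] makes moves composable without time
    shifts. *)
Definition moves (tau : R) x w x' w' := forall a,
  exists (u : R -> 'cV[R]_k) (y : R -> 'cV[R]_m) (om : R -> 'cV[R]_n),
  [/\ traj a (a + tau) u y om, y a = x, om a = w, y (a + tau) = x' & om (a + tau) = w'].

Lemma moves0 x w : moves 0 x w x w.
Proof.
move=> a; exists (fun=> 0), (fun=> x), (fun=> w); split => //; rewrite addr0; split => //.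
- move=> O; have [inO|ninO] := pselect (O 0).
    rewrite (_ : _ `&` _ = `[a, a]%classic); first exact: measurable_itv.
    by apply/seteqP; split => // t [].
  rewrite (_ : _ `&` _ = set0)//.
  by apply/seteqP; split => // t [].
- by exists 0 => s t _ _ _; rewrite subrr normr0 mul0r.
- by move=> s t _ st _; rewrite subrr normr0 mulr_ge0// subr_ge0.
- by exists [::] => t /andP[h1 h2]; move: (lt_trans h1 h2); rewrite ltxx.
Qed.

Lemma moves_trans tau tau' x w x1 w1 x2 w2 :
  moves tau x w x1 w1 -> moves tau' x1 w1 x2 w2 -> moves (tau + tau') x w x2 w2.
Proof.
move=> m1 m2 a; have [u [y [om [t1 ya oa yb ob]]]] := m1 a.
have [u' [y' [om' [t2 ya' oa' yb' ob']]]] := m2 (a + tau).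
exists (glue (a + tau) u u'), (glue (a + tau) y y'), (glue (a + tau) om om').
have [le1 _ _ _ _] := t1; have [le2 _ _ _ _] := t2.
rewrite addrA; split.
- by apply: traj_glue; rewrite ?yb ?ob.
- by rewrite glue_left.
- by rewrite glue_left.
- by rewrite glue_right// yb ya'.
- by rewrite glue_right// ob oa'.
Qed.

Lemma moves_lip tau x w x' w' : moves tau x w x' w' -> `|w' - w| <= M * tau.
Proof.
move=> /(_ 0)[u [y [om [[le_ _ _ omM _] _ <- _ <-]]]].
by have := omM 0 (0 + tau) (lexx _) le_ (lexx _); rewrite subr0 add0r.
Qed.

(** Under a constant control the state is explicit, and Picard's theorem solves the remaining
    equation. The time [h0] serves all [x], [w] and [u] because the Lipschitz constants are
    global. *)
Lemma constant_control : exists2 h0 : R, 0 < h0 &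
  exists (Phi : R -> 'M[R]_m) (Psi : R -> 'M[R]_(m, k)),
  [/\ Phi 0 = 1%:M, Psi 0 = 0, has_deriv Phi 0 A, has_deriv Psi 0 B &
    forall x w u tau, 0 < tau <= h0 ->
    exists2 om : R -> 'cV[R]_n,
      moves tau x w (Phi tau *m x + Psi tau *m u) (om tau) &
      [/\ om 0 = w, lip_on M 0 tau om &
        forall t, 0 <= t <= tau ->
          has_deriv om t (g u (Phi t *m x + Psi t *m u) (om t))]].
Proof.
have [h1 h10 [Phi [Psi [Phi0 Psi0 dPhi dPsi]]]] := linear_flow A B.
have L1 : 0 < 2 * (L + 1) by rewrite mulr_gt0// ltr_wpDl.
exists (Num.min h1 (2 * (L + 1))^-1); first by rewrite lt_min h10 invr_gt0.
exists Phi, Psi; split => //.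
- by have := dPhi 0; rewrite Phi0 mulmx1 lexx (ltW h10); exact.
- by have := dPsi 0; rewrite Psi0 mulmx0 add0r lexx (ltW h10); exact.
move=> x w u tau /andP[tau0]; rewrite le_min => /andP[tauh tauL].
pose y t := Phi t *m x + Psi t *m u.
have dy t : 0 <= t <= tau -> has_deriv y t (A *m y t + B *m u).
  move=> /andP[t0 tt]; have th : 0 <= t <= h1 by rewrite t0 (le_trans tt).
  have -> : A *m y t + B *m u = A *m Phi t *m x + (A *m Psi t + B) *m u.
    by rewrite /y mulmxDr mulmxDl !mulmxA addrA.
  by apply: has_derivD; apply: has_deriv_mulmxr; [exact: dPhi|exact: dPsi].
have tau0' := ltW tau0.
have Lt : L * tau <= 1 / 2.
  apply: le_trans (ler_wpM2l L0 tauL) _; rewrite ler_pdivrMr//; lra.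
have cy t : 0 <= t <= tau -> {for t, continuous y}.
  by move=> /dy; exact: has_deriv_continuous.
have [||om om0 dom] := @picard R n 1 (fun t => g u (y (clamp 0 tau t))) L tau w tau0 L0 Lt.
- move=> z t; apply: (@continuous_comp _ _ _ (y \o clamp 0 tau) (fun y => g u y z)).
    by apply: continuous_comp; [exact: clamp_continuous|exact/cy/clamp_itv].
  apply: (@lipschitz_continuous _ _ _ (fun y => g u y z) L) => // y1 y2.
  by apply: le_trans (gL _ _ _ _ _) _; rewrite subrr normr0 addr0.
- by move=> t z z'; apply: le_trans (gL _ _ _ _ _) _; rewrite subrr normr0 add0r.
have dom' t : 0 <= t <= tau -> has_deriv om t (g u (y t) (om t)).
  by move=> ht; have := dom t ht; rewrite clamp_id.
have omM : lip_on M 0 tau om.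
  move=> s t s0 st tt; apply: (@mean_value_ineq _ _ om (fun t => g u (y t) (om t))) => // r.
  by move=> /andP[sr rt]; apply: dom'; rewrite (le_trans s0 sr) (le_trans rt tt).
exists om; last by split.
have [Ky HKy] := continuous_itv_bounded tau0' cy.
move=> a; exists (fun=> u), (fun t => y (t - a)), (fun t => om (t - a)).
rewrite !subrr (addrC a) addrK; split => //; last by rewrite /y Phi0 Psi0 mul1mx mul0mx addr0.
split.
- by rewrite lerDr.
- move=> O; have [inO|ninO] := pselect (O u).
    rewrite (_ : _ `&` _ = `[a, tau + a]%classic); first exact: measurable_itv.
    by apply/seteqP; split => // t [].
  rewrite (_ : _ `&` _ = set0)//.
  by apply/seteqP; split => // t [].
- exists (m%:R * `|A| * Ky + `|B *m u|) => s t as_ st tt.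
  have := @mean_value_ineq _ _ y (fun t => A *m y t + B *m u) (s - a) (t - a)
    (m%:R * `|A| * Ky + `|B *m u|).
  rewrite (_ : t - a - (s - a) = t - s); last by ring.
  apply; first by rewrite lerD2r.
    by move=> r /andP[h1' h2']; apply: dy; apply/andP; split; lra.
  move=> r /andP[h1' h2']; rewrite (le_trans (ler_normD _ _))// lerD2r.
  rewrite (le_trans (mx_norm_mulmx _ _))// ler_wpM2l ?mulr_ge0//.
  by apply: HKy; apply/andP; split; lra.
- move=> s t as_ st tt; have := omM (s - a) (t - a).
  by rewrite (_ : t - a - (s - a) = t - s); [apply; lra|ring].
- exists [::] => t /andP[at_ ta] _; split; apply: has_deriv_shift.
    by apply: dy; apply/andP; split; lra.
  by apply: dom'; apply/andP; split; lra.
Qed.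

Lemma steers_moves (F : 'M[R]_m) (G : 'M[R]_(m, k)) (h : R) :
  (forall x w u, exists w', moves h x w (F *m x + G *m u) w') ->
  forall l x y w, steers F G l x y -> exists w', moves (l%:R * h) x w y w'.
Proof.
move=> H; elim=> [|l IH] x y w /=.
  by move=> ->; exists w; rewrite mul0r; exact: moves0.
move=> [x' [u [/(IH _ _ w)[w1 m1] ->]]].
have [w2 m2] := H x' w1 u; exists w2.
by rewrite -natr1 mulrDl mul1r; exact: moves_trans m2.
Qed.

(* The state [y] is first driven to the target by large controls during a
   negligible fraction of the time, then left to drift under the control [u]. *)
Lemma steer_and_hold u y (kap : R) : 0 < kap -> exists2 d0 : R, 0 < d0 &
  forall d, 0 < d <= d0 -> forall x w, exists x' w',
    moves d x w x' w' /\ `|w' - w - d *: g u y w| <= kap * d.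
Proof.
move=> kap0.
have [h0 h00 [Phi [Psi [Phi0 Psi0 dPhi dPsi cc]]]] := constant_control.
have [dc dc0 Hc] := small_time_controllable free Phi0 Psi0 dPhi dPsi.
pose kap1 := kap / (4 * (L + 1)).
have L1 : 0 < 4 * (L + 1) by rewrite mulr_gt0// ltr_wpDl.
have kap10 : 0 < kap1 by rewrite divr_gt0.
have Lkap1 : L * kap1 <= kap / 4.
  have : kap1 * (4 * (L + 1)) = kap by rewrite mulfVK// gt_eqF.
  by nra.
have dhold : has_deriv (fun t => Phi t *m y + Psi t *m u) 0 (A *m y + B *m u).
  by apply: has_derivD; exact: has_deriv_mulmxr.
(* Under the constant control [u], a state starting at [y] stays [kap1]-close to [y] up to time
   [d1]. *)
have [d1 d10 Hd1] := has_deriv_near dhold kap10.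
have LM : 0 < 8 * (L * M + 1) by rewrite mulr_gt0// ltr_wpDl// mulr_ge0.
pose d2 := kap / (8 * (L * M + 1)).
have d20 : 0 < d2 by rewrite divr_gt0.
have LMd2 : L * M * d2 <= kap / 8.
  have : d2 * (8 * (L * M + 1)) = kap by rewrite mulfVK// gt_eqF.
  by nra.
exists (Num.min (Num.min h0 (d1 / 2)) d2); first by rewrite !lt_min h00 d20 divr_gt0.
move=> d /andP[d_gt0]; rewrite !le_min => /andP[/andP[dh0 dd1] dd2] x w.
(* The share of the time [d] granted to steering: it satisfies [M * eta <= kap / 8] and is at most
   one half. *)
pose eta := kap / (8 * (M + 1) + 2 * kap).
have M0' : 0 <= M by exact: M0.
have den : 0 < 8 * (M + 1) + 2 * kap by lra.
have etaE : eta * (8 * (M + 1) + 2 * kap) = kap by rewrite mulfVK// gt_eqF.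
have eta0 : 0 < eta by rewrite divr_gt0.
have Meta : M * eta <= kap / 8 by nra.
have eta1 : eta <= 1 / 2 by rewrite ler_pdivrMr//; lra.
have m1 : 0 < m%:R + 1 :> R by rewrite ltr_wpDl.
(* All [m] steering steps together must take at most [eta * d], and each must be short enough for
   controllability; [m + 1] is a nonzero denominator. *)
pose h := Num.min (Num.min (dc / 2) h0) (eta * d / (m%:R + 1)).
have h_gt0 : 0 < h by rewrite !lt_min h00 !divr_gt0// mulr_gt0.
have hdc : h < dc.
  by apply: (@le_lt_trans _ _ (dc / 2)); [rewrite !ge_min lexx|lra].
have hh0 : h <= h0 by rewrite !ge_min lexx orbT.
pose sig := m%:R * h.
have sig0 : 0 <= sig by rewrite mulr_ge0// ltW.
have sigd : sig <= eta * d.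
  have : h <= eta * d / (m%:R + 1) by rewrite !ge_min lexx orbT.
  rewrite ler_pdivlMr// => hd; apply: le_trans hd; rewrite /sig.
  by rewrite mulrDr mulr1 mulrC lerDl ltW.
have ccm x1 w1 u1 : exists w', moves h x1 w1 (Phi h *m x1 + Psi h *m u1) w'.
  by have [|om mo _] := cc x1 w1 u1 h; [rewrite h_gt0|exists (om h)].
have [|w1 mv1] := @steers_moves (Phi h) (Psi h) h ccm m x y w.
  by apply: Hc; rewrite h_gt0.
have w1w := moves_lip mv1; rewrite -/sig in w1w mv1.
have sigd2 : sig <= d / 2 by apply: (le_trans sigd); nra.
pose d' := d - sig.
have d'0 : 0 < d' by rewrite /d'; lra.
have d'd : d' <= d by rewrite /d'; lra.
have [|om mv2 [om0 omM dom]] := cc y w1 u d'; first by rewrite d'0 (le_trans d'd).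
exists (Phi d' *m y + Psi d' *m u), (om d'); split.
  by have := moves_trans mv1 mv2; rewrite /d' addrC subrK.
(* The derivative of [om t - t *: g u y w1] is small: the state has drifted by at most [kap1] and
   [om] by at most [M * d]. *)
have hold : `|om d' - w1 - d' *: g u y w1| <= (L * (kap1 + M * d)) * d'.
  have := @mean_value_ineq _ _ (fun t => om t - t *: g u y w1)
    (fun t => g u (Phi t *m y + Psi t *m u) (om t) - g u y w1) 0 d'
    (L * (kap1 + M * d)) (ltW d'0).
  rewrite scale0r om0 !subr0 addrAC; apply.
    move=> t ht; apply: has_derivB; first exact: dom.
    move=> e e0; exists 1 => // s _.
    by rewrite -scalerBl subrr normr0 mulr_ge0// ltW.
  move=> t /andP[t0 td]; apply: le_trans (gL _ _ _ _ _) _; apply: ler_wpM2l => //.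
  apply: lerD.
    have := Hd1 t; rewrite subr0 Phi0 Psi0 mul1mx mul0mx addr0; apply.
    by rewrite ger0_norm//; lra.
  rewrite -om0 (le_trans (omM 0 t _ _ _))// ler_wpM2l// subr0; lra.
have gw : `|g u y w1 - g u y w| <= L * (M * sig).
  apply: le_trans (gL _ _ _ _ _) _; rewrite subrr normr0 add0r.
  exact: ler_wpM2l.
(* The four errors: the hold, the displacement while steering, the change of base point from [w1] to
   [w], and the time lost by steering. *)
have -> : om d' - w - d *: g u y w = (om d' - w1 - d' *: g u y w1) + (w1 - w)
    + d' *: (g u y w1 - g u y w) - sig *: g u y w.
  by rewrite /d'; apply/matrixP => i j; rewrite !mxE; ring.
apply: le_trans (ler_normB _ _) _.
have := ler_normD (om d' - w1 - d' *: g u y w1 + (w1 - w)) (d' *: (g u y w1 - g u y w)).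
have := ler_normD (om d' - w1 - d' *: g u y w1) (w1 - w).
rewrite (normrZ d') (normrZ sig) (gtr0_norm d'0) (ger0_norm sig0) => n1 n2.
have t1 : L * (kap1 + M * d) * d' <= (kap / 4 + kap / 8) * d.
  apply: ler_pM => //; first by rewrite mulr_ge0// addr_ge0 ?(ltW kap10)// mulr_ge0// ltW.
    by rewrite ltW.
  rewrite mulrDr lerD// mulrA (le_trans _ LMd2)// ler_wpM2l// mulr_ge0//.
have t2 : M * sig <= kap / 8 * d.
  by apply: le_trans (ler_wpM2l M0 sigd) _; rewrite mulrA ler_wpM2r// ltW.
have t3 : d' * `|g u y w1 - g u y w| <= kap / 8 * d.
  rewrite mulrC; apply: ler_pM => //; first exact: ltW.
  apply: le_trans gw _; rewrite mulrA (le_trans _ LMd2)// ler_wpM2l ?mulr_ge0//; lra.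
have t4 : sig * `|g u y w| <= M * sig by rewrite mulrC ler_wpM2r.
have kd : 0 <= kap * d by rewrite mulr_ge0 ?(ltW kap0) ?(ltW d_gt0).
lra.
Qed.

(** The time is cut into [N] equal blocks of length at most [d0], each steering back to [y] from
    wherever the previous one ended. The term [L * M * tau] pays for the drift of [w]. *)
Lemma constant_step u y (kap tau : R) x w : 0 < kap -> 0 <= tau ->
  exists x' w', moves tau x w x' w' /\
    `|w' - w - tau *: g u y w| <= tau * (kap + L * M * tau).
Proof.
move=> kap0; rewrite le_eqVlt => /orP[/eqP<-|tau0].
  by exists x, w; split; [exact: moves0|rewrite scale0r subr0 subrr normr0 mul0r].
have [d0 d00 H] := steer_and_hold u y kap0.
have := archi_boundP (ltW (divr_gt0 tau0 d00)); set N := Num.bound _ => tN.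
have N0 : 0 < N%:R :> R by apply: lt_trans tN; rewrite divr_gt0.
pose d := tau / N%:R.
have d_gt0 : 0 < d by rewrite divr_gt0.
have dd0 : d <= d0.
  by rewrite ler_pdivrMr// mulrC -ler_pdivrMr// ltW.
have NdE : N%:R * d = tau by rewrite /d mulrC mulfVK// gt_eqF.
suff ind i : (i <= N)%N -> exists x' w', moves (i%:R * d) x w x' w' /\
    `|w' - w - (i%:R * d) *: g u y w| <= (i%:R * d) * (kap + L * M * tau).
  by have := ind N (leqnn _); rewrite NdE.
elim: i => [_|i IH iN].
  by exists x, w; rewrite mul0r; split; [exact: moves0|rewrite scale0r subr0 subrr normr0 mul0r].
have [x1 [w1 [mv1 H1]]] := IH (ltnW iN).
have [|x2 [w2 [mv2 H2]]] := H d _ x1 w1; first by rewrite d_gt0.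
exists x2, w2; rewrite -natr1 mulrDl mul1r; split; first exact: moves_trans mv2.
have idtau : i%:R * d <= tau by rewrite -NdE ler_wpM2r ?ltW// ltr_nat.
have w1w := moves_lip mv1.
have gw : `|g u y w1 - g u y w| <= L * (M * tau).
  apply: le_trans (gL _ _ _ _ _) _; rewrite subrr normr0 add0r ler_wpM2l//.
  by apply: le_trans w1w _; rewrite ler_wpM2l.
set c := i%:R * d in H1 *.
have -> : w2 - w - (c + d) *: g u y w = (w2 - w1 - d *: g u y w1) +
    (w1 - w - c *: g u y w) + d *: (g u y w1 - g u y w).
  by apply/matrixP => i' j; rewrite !mxE; ring.
apply: le_trans (ler_normD _ _) _.
have := ler_normD (w2 - w1 - d *: g u y w1) (w1 - w - c *: g u y w).
rewrite normrZ (gtr0_norm d_gt0) => n1.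
have t1 : d * `|g u y w1 - g u y w| <= d * (L * (M * tau)) by rewrite ler_wpM2l// ltW.
lra.
Qed.

Lemma convex_step N (lam : 'I_N -> R) (us : 'I_N -> 'cV[R]_k) (ys : 'I_N -> 'cV[R]_m)
    (kap tau : R) x w : 0 < kap -> 0 <= tau ->
  (forall i, 0 <= lam i) -> \sum_i lam i <= 1 ->
  exists x' w', moves (tau * \sum_i lam i) x w x' w' /\
    `|w' - w - tau *: \sum_i lam i *: g (us i) (ys i) w| <=
      tau * (\sum_i lam i) * (kap + 2 * L * M * tau).
Proof.
move=> kap0 tau0; elim: N lam us ys => [|N IH] lam us ys lam0.
  rewrite !big_ord0 mulr0 mul0r scaler0 => _; exists x, w.
  by split; [exact: moves0|rewrite subr0 subrr normr0].
rewrite !big_ord_recr /=.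
set S := \sum_(i < N) lam _; set l := lam ord_max => Sl.
have l0 : 0 <= l by exact: lam0.
have S0 : 0 <= S by apply: sumr_ge0.
have [||x1 [w1 [mv1 H1]]] := IH (fun i => lam (widen_ord (leqnSn N) i))
  (fun i => us (widen_ord (leqnSn N) i)) (fun i => ys (widen_ord (leqnSn N) i)).
- by move=> i; exact: lam0.
- by rewrite -/S; lra.
rewrite -/S in mv1 H1; set Gs := \sum_(i < N) _ in H1 *.
set u := us ord_max; set y := ys ord_max.
have tl0 : 0 <= tau * l by rewrite mulr_ge0.
have [x2 [w2 [mv2 H2]]] := constant_step u y x1 w1 kap0 tl0.
exists x2, w2; rewrite !mulrDr; split; first exact: moves_trans mv2.
have w1w := moves_lip mv1.
have gw : `|g u y w1 - g u y w| <= L * (M * tau).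
  apply: le_trans (gL _ _ _ _ _) _; rewrite subrr normr0 add0r ler_wpM2l//.
  by apply: le_trans w1w _; rewrite ler_wpM2l// ler_piMr//; lra.
have -> : w2 - w - tau *: (Gs + l *: g u y w) = (w2 - w1 - (tau * l) *: g u y w1) +
    (w1 - w - tau *: Gs) + (tau * l) *: (g u y w1 - g u y w).
  by apply/matrixP => i' j; rewrite !mxE; ring.
apply: le_trans (ler_normD _ _) _.
have := ler_normD (w2 - w1 - (tau * l) *: g u y w1) (w1 - w - tau *: Gs).
rewrite normrZ (ger0_norm tl0) => n1.
have t1 : tau * l * `|g u y w1 - g u y w| <= tau * l * (L * (M * tau)) by rewrite ler_wpM2l.
have t2 : tau * l * (kap + L * M * (tau * l)) <= tau * l * (kap + L * M * tau).
  rewrite ler_wpM2l// lerD2l ler_wpM2l ?mulr_ge0// ler_piMr//; lra.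
lra.
Qed.

(** In the application [zeta] lies on the curve to be followed and [w] on the trajectory. The
    weights and controls of [p] are reused at [w], at the cost of [L * |w - zeta|]. *)
Lemma hull_step (zeta p : 'cV[R]_n) (kap tau : R) x w : 0 < kap -> 0 <= tau ->
  conv_hull [set g u y zeta | u in [set: 'cV[R]_k] & y in [set: 'cV[R]_m]] p ->
  exists x' w', moves tau x w x' w' /\
    `|w' - w - tau *: p| <= tau * (kap + 2 * L * M * tau + L * `|w - zeta|).
Proof.
move=> kap0 tau0 [N [lam [ps [lam0 [lam1 [psS ->]]]]]].
have /choice[uy Huy] : forall i, exists uy, g uy.1 uy.2 zeta = ps i.
  by move=> i; have [u _ [y _ <-]] := psS i; exists (u, y).
have [|x' [w' [mv H]]] := @convex_step N lam (fst \o uy) (snd \o uy) kap tau x w kap0 tau0 lam0.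
  by rewrite lam1.
exists x', w'; rewrite lam1 !mulr1 in mv H; split => //.
set G := \sum_i _ in H.
have GP : `|G - \sum_i lam i *: ps i| <= L * `|w - zeta|.
  rewrite -sumrB (le_trans (ler_norm_sum _ _ _))//.
  rewrite -[leRHS]mul1r -lam1 mulr_suml; apply: ler_sum => i _.
  rewrite -scalerBr normrZ ger0_norm// ler_wpM2l// -Huy.
  by apply: le_trans (gL _ _ _ _ _) _; rewrite subrr normr0 add0r.
set P := \sum_i _ in GP *.
have -> : w' - w - tau *: P = (w' - w - tau *: G) + tau *: (G - P).
  by apply/matrixP => i j; rewrite !mxE; ring.
apply: le_trans (ler_normD _ _) _; rewrite normrZ ger0_norm//.
have := ler_wpM2l tau0 GP; lra.
Qed.

End Trajectories.

(** * Velocity sets *)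

Section AlmostEverywhere.
Context {R : realType}.
Notation mu := (@lebesgue_measure R).

Lemma negligible_seq (F : seq R) : mu.-negligible [set` F].
Proof.
have cF : countable [set` F] by apply: finite_set_countable; exact: finite_seq.
exists [set` F]; split => //; last exact: countable_lebesgue_measure0.
exact: countable_measurable.
Qed.

Lemma ae_on_interior (T : R) (F : seq R) (P : R -> Prop) :
  {ae mu, forall t, 0 < t < T -> t \notin F -> P t} -> ae_on T P.
Proof.
move=> aeP; apply: negligibleS (negligibleU aeP (negligible_seq [:: 0, T & F])).
move=> t /= nP; have [tF|tF] := boolP (t \in [:: 0, T & F]); [by right|left].
apply: contra_not nP => H; rewrite in_itv /= => /andP[t0 tT]; apply: H.
  move: tF; rewrite !inE !negb_or => /and3P[tn0 tnT _].
  by rewrite !lt_neqAle t0 tT tnT eq_sym tn0.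
by move: tF; rewrite !inE !negb_or => /and3P[].
Qed.

Lemma ae_onS (T : R) (P Q : R -> Prop) : (forall t, P t -> Q t) ->
  ae_on T P -> ae_on T Q.
Proof. by move=> PQ; apply: negligibleS => t /=; apply: contra_not => H /H; exact: PQ. Qed.

Lemma abs_cont_onS (V : normedModType R) (a b a' b' : R) (f : R -> V) :
  a <= a' -> b' <= b -> abs_cont_on a b f -> abs_cont_on a' b' f.
Proof.
move=> aa' bb' ac e /ac[d d0 H]; exists d => // N s t st; apply: H => i.
by have [h1 [h2 h3]] := st i; split; [exact: le_trans h1|split => //; exact: le_trans h3 _].
Qed.

Lemma lip_on_abs_cont (V : normedModType R) (K a b : R) (f : R -> V) :
  0 <= K -> lip_on K a b f -> abs_cont_on a b f.
Proof.
move=> K0 fK e e0; have K1 : 0 < K + 1 by rewrite ltr_wpDl.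
exists (e / (K + 1)); first by rewrite divr_gt0.
move=> N s t st _; rewrite ltr_pdivlMr// => sd.
have ge0 : 0 <= \sum_(i < N) (t i - s i).
  by apply: sumr_ge0 => i _; have [_ [h _]] := st i; rewrite subr_ge0.
apply: (@le_lt_trans _ _ (K * \sum_(i < N) (t i - s i))); last lra.
rewrite mulr_sumr; apply: ler_sum => i _; have [h1 [h2 h3]] := st i.
exact: fK.
Qed.

Lemma lipschitz_ae_derivable_mx (p q : nat) (K T : R) (f : R -> 'M[R]_(p, q)) :
  lip_on K 0 T f -> {ae mu, forall t, 0 < t < T -> derivable f t 1}.
Proof.
move=> fK.
have H (ij : 'I_p * 'I_q) : {ae mu, forall t, 0 < t < T ->
    derivable (fun s => f s ij.1 ij.2) t 1}.
  apply: (@lipschitz_ae_derivable _ _ _ _ K).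
  have wlog_ x y : 0 <= x <= T -> 0 <= y <= T -> x <= y ->
      `|f y ij.1 ij.2 - f x ij.1 ij.2| <= K * `|y - x|.
    move=> /andP[x0 xT] /andP[y0 yT] xy; rewrite [`|y - x|]ger0_norm ?subr_ge0//.
    apply: le_trans _ (fK _ _ x0 xy yT).
    by have := mx_norm_entry (f y - f x) ij.1 ij.2; rewrite !mxE.
  move=> x y hx hy; have [xy|/ltW yx] := leP x y; last exact: wlog_.
  by rewrite distrC (distrC x); exact: wlog_.
have := @filter_forall _ _ _ _ (ae_filter_ringOfSetsType mu) H.
apply: filterS.
by move=> t Ht t0T; apply/derivable_mxP => i j; exact: (Ht (i, j)).
Qed.

End AlmostEverywhere.

(** * Convex hulls of the velocities *)

Section Hulls.
Context {R : realType}.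

Lemma conv_hull_convex (V : lmodType R) (S : set V) : convex_closed (conv_hull S).
Proof.
move=> x y a b [N [lam [p [lam0 [lam1 [Sp ->]]]]]] [N' [lam' [p' [lam0' [lam1' [Sp' ->]]]]]] a0 b0 ab.
exists (N + N')%N.
exists (fun i => match fintype.split i with inl j => a * lam j | inr j => b * lam' j end).
exists (fun i => match fintype.split i with inl j => p j | inr j => p' j end).
split; [|split; [|split]].
- by move=> i; case: (fintype.split i) => j; rewrite mulr_ge0.
- rewrite big_split_ord /=.
  under eq_bigr do rewrite (unsplitK (inl _ _)).
  under [X in _ + X]eq_bigr do rewrite (unsplitK (inr _ _)).
  by rewrite -!mulr_sumr lam1 lam1' !mulr1.
- by move=> i; case: (fintype.split i) => j.
- rewrite big_split_ord /=.
  under [X in _ = X + _]eq_bigr do rewrite (unsplitK (inl _ _)) -scalerA.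
  under [X in _ = _ + X]eq_bigr do rewrite (unsplitK (inr _ _)) -scalerA.
  by rewrite -!scaler_sumr.
Qed.

Context {m k n : nat} (g : 'cV[R]_k -> 'cV[R]_m -> 'cV[R]_n -> 'cV[R]_n) (M L : R).
Hypothesis gM : forall u y z, `|g u y z| <= M.
Hypothesis L0 : 0 <= L.
Hypothesis gL : forall u y1 z1 y2 z2,
  `|g u y1 z1 - g u y2 z2| <= L * (`|y1 - y2| + `|z1 - z2|).
Implicit Types (z p v : 'cV[R]_n).

Definition hull z : set 'cV[R]_n :=
  conv_hull [set g u y z | u in [set: 'cV[R]_k] & y in [set: 'cV[R]_m]].

(** Enlargements of the unclosed hull, convex and with intersection [Vset g z] over [r > 0]. They
    stand in for the closure in all estimates. *)
Definition near_hull z (r : R) : set 'cV[R]_n := [set v | exists2 p, hull z p & `|v - p| <= r].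

Lemma hull_nonempty z : hull z !=set0.
Proof.
exists (g 0 0 z), 1%N, (fun=> 1), (fun=> g 0 0 z); split => //; split.
  by rewrite big_ord1.
by split; [move=> _; exists 0 => //; exists 0|rewrite big_ord1 scale1r].
Qed.

Lemma hull_norm z p : hull z p -> `|p| <= M.
Proof.
move=> [N [lam [q [lam0 [lam1 [Sq ->]]]]]].
rewrite (le_trans (ler_norm_sum _ _ _))// -[M]mul1r -lam1 mulr_suml.
apply: ler_sum => i _; rewrite normrZ ger0_norm// ler_wpM2l//.
by have [u _ [y _ <-]] := Sq i.
Qed.

(** The weights and the pairs [(u, y)] are kept; only the base point changes, and [g] is Lipschitz
    in it. *)
Lemma hull_shift z z' p : hull z p -> near_hull z' (L * `|z - z'|) p.
Proof.
move=> [N [lam [q [lam0 [lam1 [Sq ->]]]]]].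
have /choice[uy Huy] : forall i, exists uy, g uy.1 uy.2 z = q i.
  by move=> i; have [u _ [y _ <-]] := Sq i; exists (u, y).
exists (\sum_i lam i *: g (uy i).1 (uy i).2 z').
  exists N, lam, (fun i => g (uy i).1 (uy i).2 z'); split => //; split => //; split => //.
  by move=> i; exists (uy i).1 => //; exists (uy i).2.
rewrite -sumrB (le_trans (ler_norm_sum _ _ _))//.
rewrite -[leRHS]mul1r -lam1 mulr_suml; apply: ler_sum => i _.
rewrite -scalerBr normrZ ger0_norm// ler_wpM2l// -Huy.
by apply: le_trans (gL _ _ _ _ _) _; rewrite subrr normr0 add0r.
Qed.

Lemma near_hull_convex z r : convex_closed (near_hull z r).
Proof.
move=> x y a b [p Hp xp] [q Hq yq] a0 b0 ab.
exists (a *: p + b *: q); first exact: conv_hull_convex.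
have -> : a *: x + b *: y - (a *: p + b *: q) = a *: (x - p) + b *: (y - q).
  by rewrite !scalerBr opprD addrACA.
rewrite (le_trans (ler_normD _ _))// !normrZ !ger0_norm//.
by have := ler_wpM2l a0 xp; have := ler_wpM2l b0 yq; nra.
Qed.

Lemma near_hull_shift z z' r v : near_hull z r v -> near_hull z' (r + L * `|z - z'|) v.
Proof.
move=> [p /(hull_shift z')[q Hq pq] vp]; exists q => //.
by rewrite -(subrKA p) (le_trans (ler_normD _ _))// lerD.
Qed.

Lemma VsetP z v : Vset g z v <-> forall e : R, 0 < e -> near_hull z e v.
Proof.
split=> [cv e e0|H].
  have [p [Hp]] := cv _ (nbhsx_ballx v e e0).
  by rewrite -ball_normE /= => /ltW vp; exists p.
move=> U /nbhs_ballP[e /= e0 eU]; have [p Hp vp] := H (e / 2) (divr_gt0 e0 (ltr0n _ 2)).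
exists p; split => //; apply: eU; rewrite -ball_normE /=.
by apply: le_lt_trans vp _; lra.
Qed.

Context (T : R) (w : R -> 'cV[R]_n) (E : set R).
Hypothesis acw : abs_cont_on 0 T w.
Hypothesis nE : (@lebesgue_measure R).-negligible E.
Hypothesis dw : forall t, 0 <= t <= T -> ~ E t ->
  exists2 l, has_deriv w t l & Vset g (w t) l.

(** Almost all velocities lie in the convex ball of radius [M], so mean velocities do too, up to any
    error. *)
Lemma inclusion_lip : lip_on M 0 T w.
Proof.
move=> s t s0 st tT; apply/ler_addgt0Pr => e e0.
have M0 : 0 <= M by exact: le_trans (normr_ge0 _) (gM 0 0 0).
have [||||c /= cM H] := @abs_cont_mean_value _ _ w s t [set v | `|v| <= M] E st _ _ _ nE _ _ e0.
- exact: abs_cont_onS acw.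
- move=> x y a b /= xM yM a0 b0 ab; rewrite (le_trans (ler_normD _ _))//.
  rewrite !normrZ !ger0_norm//.
  by have := ler_wpM2l a0 xM; have := ler_wpM2l b0 yM; nra.
- by exists 0; rewrite /= normr0.
- move=> x /andP[sx xt] nEx.
  have [|l dl Vl] := dw _ nEx; first by rewrite (le_trans s0 sx) (le_trans xt tT).
  exists l => //=; apply/ler_addgt0Pr => e1 e10.
  have [p Hp lp] := (VsetP _ _).1 Vl e1 e10.
  rewrite -(subrK p l) (le_trans (ler_normD _ _))// addrC lerD//.
  exact: hull_norm Hp.
rewrite -(subrK ((t - s) *: c) (w t - w s)) (le_trans (ler_normD _ _))// addrC lerD//.
by rewrite normrZ ger0_norm ?subr_ge0// mulrC ler_wpM2r// subr_ge0.
Qed.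

(** While [w] is within [r] of [z], its velocities lie in a convex enlargement of [hull z]. Half of
    [e] pays for the closure in [Vset], half for the mean value lemma. *)
Lemma inclusion_increment s t z (r e : R) : 0 <= s -> s < t -> t <= T ->
  (forall x, s <= x <= t -> `|w x - z| <= r) -> 0 < e ->
  exists2 p, hull z p & `|w t - w s - (t - s) *: p| <= (t - s) * (L * r + e).
Proof.
move=> s0 st tT wr e0.
have ts : 0 < t - s by rewrite subr_gt0.
have e1 : 0 < (t - s) * (e / 2) by rewrite mulr_gt0// divr_gt0.
have e2 : 0 < e / 2 by rewrite divr_gt0.
have [||||c [p Hp cp] H] := @abs_cont_mean_value _ _ w s t (near_hull z (L * r + e / 2)) E
  (ltW st) _ _ _ nE _ _ e1.
- exact: abs_cont_onS acw.
- exact: near_hull_convex.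
- have [q Hq] := hull_nonempty z; exists q, q => //; rewrite subrr normr0.
  rewrite addr_ge0 ?(ltW e2)// mulr_ge0//.
  by apply: (le_trans (normr_ge0 (w s - z))); apply: wr; rewrite lexx ltW.
- move=> x /andP[sx xt] nEx.
  have [|l dl Vl] := dw _ nEx; first by rewrite (le_trans s0 sx) (le_trans xt tT).
  exists l => //; have := (VsetP _ _).1 Vl _ e2.
  move=> /(near_hull_shift z)[q Hq lq]; exists q => //; apply: le_trans lq _.
  by rewrite addrC lerD2r ler_wpM2l// wr// sx.
exists p => //.
have -> : w t - w s - (t - s) *: p = (w t - w s - (t - s) *: c) + (t - s) *: (c - p).
  by rewrite scalerBr addrA subrK.
rewrite (le_trans (ler_normD _ _))// normrZ (gtr0_norm ts).
have := ler_wpM2l (ltW ts) cp; lra.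
Qed.

End Hulls.

(** * Relaxation *)

Section RelaxationTheorem.
Context {R : realType} {m k n : nat}.
Context (g : 'cV[R]_k -> 'cV[R]_m -> 'cV[R]_n -> 'cV[R]_n) (M L : R).
Hypothesis gM : forall u y z, `|g u y z| <= M.
Hypothesis L0 : 0 <= L.
Hypothesis gL : forall u y1 z1 y2 z2,
  `|g u y1 z1 - g u y2 z2| <= L * (`|y1 - y2| + `|z1 - z2|).
Context (y0 : 'cV[R]_m) (z0 : 'cV[R]_n) (T : R).
Hypothesis T0 : 0 < T.
Notation mu := (@lebesgue_measure R).

Lemma bound_ge0 : 0 <= M.
Proof. exact: le_trans (normr_ge0 _) (gM 0 0 0). Qed.

Lemma Z_incl_has_deriv w : Z_incl g z0 T w -> exists2 E : set R, mu.-negligible E &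
  forall t, 0 <= t <= T -> ~ E t -> exists2 l, has_deriv w t l & Vset g (w t) l.
Proof.
move=> [_ [_ aew]]; eexists; first exact: aew.
move=> t tT /contrapT /=; rewrite in_itv/= => /(_ tT)[dw Vw].
by exists ('D_1 w t) => //; apply/has_derivP.
Qed.

Lemma Z_incl_lip w : Z_incl g z0 T w -> lip_on M 0 T w.
Proof.
move=> Zw; have [E nE dw] := Z_incl_has_deriv Zw; have [acw _] := Zw.
exact: (inclusion_lip gM acw nE dw).
Qed.

Lemma Z_incl_increment w : Z_incl g z0 T w ->
  forall s t z (r e : R), 0 <= s -> s < t -> t <= T ->
  (forall x, s <= x <= t -> `|w x - z| <= r) -> 0 < e ->
  exists2 p, hull g z p & `|w t - w s - (t - s) *: p| <= (t - s) * (L * r + e).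
Proof.
move=> Zw; have [E nE dw] := Z_incl_has_deriv Zw; have [acw _] := Zw.
exact: (inclusion_increment L0 gL acw nE dw).
Qed.

Lemma Z_eps_sub_Z_incl (A : 'M[R]_m) (B : 'M[R]_(m, k)) (eps : R) :
  Z_eps A B g y0 z0 T eps `<=` Z_incl g z0 T.
Proof.
move=> z [u [y [_ [_ [_ [_ [acz [z0E aez]]]]]]]]; split => //; split => //.
apply: ae_onS aez => t [dz ->]; split => //.
apply: subset_closure; exists 1%N, (fun=> 1), (fun=> g (u t) (y t) (z t)).
split => //; split; first by rewrite big_ord1.
by split; [move=> _; exists (u t) => //; exists (y t)|rewrite big_ord1 scale1r].
Qed.

Lemma unif_closure_Z_incl (S : set (R -> 'cV[R]_n)) : S `<=` Z_incl g z0 T ->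
  unif_closure T S `<=` Z_incl g z0 T.
Proof.
move=> SZ z clz.
have approx (e : R) : 0 < e -> exists2 w, Z_incl g z0 T w &
    forall t, 0 <= t <= T -> `|z t - w t| <= e.
  by move=> /clz[w /SZ Zw H]; exists w => // t tT; apply: H; rewrite /= in_itv.
have zM : lip_on M 0 T z.
  move=> s t s0 st tT; apply/ler_addgt0Pr => e e0.
  have [w Zw H] := approx (e / 2) (divr_gt0 e0 (ltr0n _ 2)).
  have h1 := H t; have h2 := H s.
  have {}h1 := h1 (introT andP (conj (le_trans s0 st) tT)).
  have {}h2 := h2 (introT andP (conj s0 (le_trans st tT))).
  have h3 := Z_incl_lip Zw s0 st tT.
  have -> : z t - z s = (z t - w t) - (z s - w s) + (w t - w s).
    by apply/matrixP => i j; rewrite !mxE; ring.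
  rewrite (le_trans (ler_normD _ _))//.
  have := ler_normB (z t - w t) (z s - w s); lra.
split; first exact: lip_on_abs_cont bound_ge0 zM.
split.
  apply/eqP; rewrite -subr_eq0 -normr_le0; apply/ler_addgt0Pr => e e0; rewrite add0r.
  have [w [_ [<- _]] H] := approx e e0.
  by apply: H; rewrite lexx ltW.
apply: (@ae_on_interior _ _ [::]); have := lipschitz_ae_derivable_mx zM.
apply: filterS; first exact: (ae_filter_ringOfSetsType mu).
move=> t dz tT _; have {}dz := dz tT; split => //.
have /has_derivP dl : derivable z t 1 /\ 'D_1 z t = 'D_1 z t by [].
move: ('D_1 z t) dl => l dl; case/andP: tT => t0 tT.
(* Five errors of size [r * h] will add up: one from the derivative of [z], two from the distance to
   [w] at the end points, two from the increment of [w]. *)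
apply/VsetP => e e0; pose r := e / 5.
have r0 : 0 < r by rewrite divr_gt0.
have [d d0 Hd] := dl r r0.
have M0 := bound_ge0.
have den : 0 < L * (r + M) + 1 by rewrite ltr_wpDl// mulr_ge0// addr_ge0// ltW.
pose h := Num.min (Num.min (d / 2) (T - t)) (r / (L * (r + M) + 1)).
have h0 : 0 < h by rewrite !lt_min subr_gt0 tT !divr_gt0.
have hd : h < d by apply: (@le_lt_trans _ _ (d / 2)); [rewrite !ge_min lexx|lra].
have hT : h <= T - t by rewrite !ge_min lexx orbT.
have hr : L * (r + M) * h <= r.
  have : h <= r / (L * (r + M) + 1) by rewrite !ge_min lexx orbT.
  rewrite ler_pdivlMr//; nra.
(* The approximant is chosen after [h], with accuracy [r * h], so that division by [h] leaves errors
   of order [r]. *)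
have [w Zw Hw] := approx (r * h) (mulr_gt0 r0 h0).
have tth : t < t + h by rewrite ltrDl.
have thT : t + h <= T by lra.
have [||p Hp wp] := @Z_incl_increment w Zw t (t + h) (z t) (r * h + M * h) r (ltW t0) tth thT.
- move=> x /andP[tx xth].
  have -> : w x - z t = (z x - z t) - (z x - w x).
    by apply/matrixP => i j; rewrite !mxE; ring.
  rewrite (le_trans (ler_normB _ _))// addrC lerD//.
    by apply: Hw; apply/andP; split; lra.
  apply: le_trans (zM t x (ltW t0) tx _) _; first lra.
  by rewrite ler_wpM2l//; lra.
- exact: r0.
exists p => //.
have := Hd (t + h); rewrite (addrC t) addrK gtr0_norm// => /(_ hd) dz1.
rewrite (addrC t) addrK in wp.
have w1 : `|z (h + t) - w (h + t)| <= r * h by apply: Hw; apply/andP; split; lra.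
have w2 : `|z t - w t| <= r * h by apply: Hw; rewrite !ltW.
have : `|h *: (l - p)| <= 5 * r * h.
  have -> : h *: (l - p) = (w (h + t) - w t - h *: p) - (z (h + t) - z t - h *: l)
      + (z (h + t) - w (h + t)) - (z t - w t).
    by apply/matrixP => i j; rewrite !mxE; ring.
  rewrite (le_trans (ler_normB _ _))//.
  have n1 := ler_normD (w (h + t) - w t - h *: p - (z (h + t) - z t - h *: l))
    (z (h + t) - w (h + t)).
  have n2 := ler_normB (w (h + t) - w t - h *: p) (z (h + t) - z t - h *: l).
  have : L * (r * h + M * h) * h <= r * h.
    by rewrite -mulrDl mulrA ler_wpM2r// ltW.
  lra.
rewrite normrZ gtr0_norm// mulrC ler_pM2r// => H; apply: le_trans H _.
by rewrite /r mulrC mulfVK.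
Qed.

(** * Approximating solutions of the inclusion *)

Context (A : 'M[R]_m) (B : 'M[R]_(m, k)) (eps : R).
Hypothesis eps0 : 0 < eps.
Hypothesis free : row_free (ctrb (eps^-1 *: A) (eps^-1 *: B) m).

Lemma traj_Z_eps u y w : traj (eps^-1 *: A) (eps^-1 *: B) g M 0 T u y w ->
  y 0 = y0 -> w 0 = z0 -> Z_eps A B g y0 z0 T eps w.
Proof.
move=> [_ mu_ [K yK] wM [F dF]] yE wE.
have derivF : {ae mu, forall t, 0 < t < T -> t \notin F ->
    has_deriv y t (eps^-1 *: A *m y t + eps^-1 *: B *m u t) /\
    has_deriv w t (g (u t) (y t) (w t))} by apply: aeW => t; exact: dF.
exists u, y; split.
  move=> O _; exists (`[0, T]%classic `&` u @^-1` O); split; first exact: mu_.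
  by rewrite setDv setU0; exact: negligible_set0.
split; first by apply: (@lip_on_abs_cont _ _ `|K|) => //; apply: lip_onW yK; exact: ler_norm.
split => //; split.
  apply: (@ae_on_interior _ _ F); move: derivF; apply: filterS.
    exact: (ae_filter_ringOfSetsType mu).
  move=> t H tT tF; have [/has_derivP[dy ->] _] := H tT tF; split => //.
  by rewrite -!scalemxAl -scalerDr scalerA divff ?gt_eqF// scale1r.
split; first exact: lip_on_abs_cont bound_ge0 wM.
split => //; apply: (@ae_on_interior _ _ F); move: derivF; apply: filterS.
  exact: (ae_filter_ringOfSetsType mu).
by move=> t H tT tF; have [_ /has_derivP] := H tT tF.
Qed.

Lemma Z_incl_approx z (e : R) : Z_incl g z0 T z -> 0 < e ->
  exists2 w, Z_eps A B g y0 z0 T eps w & forall t, 0 <= t <= T -> `|z t - w t| <= e.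
Proof.
move=> Zz e0; have M0 := bound_ge0; have zM := Z_incl_lip Zz.
have zE : z 0 = z0 by case: Zz => _ [].
pose X := expR (L * T).
have X0 : 0 < X by exact: expR_gt0.
(* Local errors amount to [3 * kap] per unit of time; amplified by at most [X] over [0, T], they
   total [e / 2]. *)
pose kap := e / (6 * T * X).
have TX : 0 < 6 * T * X by rewrite !mulr_gt0.
have kap0 : 0 < kap by rewrite divr_gt0.
have kapE : T * (3 * kap) * X = e / 2.
  have : kap * (6 * T * X) = e by rewrite mulfVK// gt_eqF.
  lra.
(* On cells this short, second-order terms cost at most [kap] per unit of time, and two
   [M]-Lipschitz curves separate by at most [e / 2] more. *)
pose D := Num.min (kap / (3 * L * M + 1)) (e / (4 * M + 1)).
have D1 : 0 < 3 * L * M + 1 by rewrite ltr_wpDl// !mulr_ge0.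
have D2 : 0 < 4 * M + 1 by rewrite ltr_wpDl// mulr_ge0.
have D0 : 0 < D by rewrite lt_min !divr_gt0.
have := archi_boundP (ltW (divr_gt0 T0 D0)); set N := Num.bound _ => tN.
have N0 : 0 < N%:R :> R by apply: lt_trans tN; rewrite divr_gt0.
pose d := T / N%:R.
have d0 : 0 < d by rewrite divr_gt0.
have dD : d <= D by rewrite ler_pdivrMr// mulrC -ler_pdivrMr// ltW.
have NdE : N%:R * d = T by rewrite /d mulrC mulfVK// gt_eqF.
have LMd : 3 * L * M * d <= kap.
  have : d <= kap / (3 * L * M + 1) by apply: le_trans dD _; rewrite ge_min lexx.
  by rewrite ler_pdivlMr//; nra.
have Md : 2 * M * d <= e / 2.
  have : d <= e / (4 * M + 1) by apply: le_trans dD _; rewrite ge_min lexx orbT.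
  by rewrite ler_pdivlMr//; nra.
have q1 : 1 <= 1 + L * d by rewrite lerDl mulr_ge0// ltW.
have powX i : (i <= N)%N -> (1 + L * d) ^+ i <= X.
  move=> iN; apply: (@le_trans _ _ ((1 + L * d) ^+ N)).
    exact: ler_weXn2l.
  rewrite /X -NdE (mulrCA L N%:R) expRM_natl.
  by rewrite lerXn2r ?nnegrE ?expR_ge1Dx ?expR_ge0// (le_trans ler01 q1).
(* discrete Gronwall bound for the error at the [i]-th node of the grid *)
pose b i := i%:R * d * (3 * kap) * (1 + L * d) ^+ i.
have q0 : 0 <= 1 + L * d := le_trans ler01 q1.
have b0 i : 0 <= i%:R * d * (3 * kap).
  by apply: mulr_ge0; apply: mulr_ge0 => //; exact: ltW.
have be i : (i <= N)%N -> b i <= e / 2.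
  move=> iN; rewrite -kapE; apply: ler_pM.
  - exact: b0.
  - exact: exprn_ge0.
  - apply: ler_wpM2r; first by apply: mulr_ge0 => //; exact: ltW.
    by rewrite -[leRHS]NdE ler_wpM2r ?(ltW d0)// ler_nat.
  - exact: powX.
(* The Gronwall recursion: old errors grow by the factor [1 + L * d], and [d * (3 * kap)] is
   added. *)
have bS i : b i + d * (L * b i + 3 * kap) <= b i.+1.
  have -> : b i.+1 = b i * (1 + L * d) + d * (3 * kap) * (1 + L * d) ^+ i.+1.
    by rewrite /b -natr1 exprS; ring.
  have : d * (3 * kap) <= d * (3 * kap) * (1 + L * d) ^+ i.+1.
    apply: ler_peMr; last exact: exprn_ege1.
    by apply: mulr_ge0; [exact: ltW|apply: mulr_ge0 => //; exact: ltW].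
  lra.
suff ind i : (i <= N)%N -> exists u y w,
    [/\ traj (eps^-1 *: A) (eps^-1 *: B) g M 0 (i%:R * d) u y w, y 0 = y0, w 0 = z0,
      `|w (i%:R * d) - z (i%:R * d)| <= b i &
      forall t, 0 <= t <= i%:R * d -> `|z t - w t| <= e].
  have [u [y [w [tr yE wE _ H]]]] := ind N (leqnn _); rewrite NdE in tr H.
  by exists w => //; exact: traj_Z_eps tr yE wE.
elim: i => [_|i IH iN].
  have [u [y [w [tr yE wE _ _]]]] := moves0 (eps^-1 *: A) (eps^-1 *: B) gM y0 z0 0.
  rewrite add0r in tr; exists u, y, w; rewrite mul0r; split => //.
    by rewrite wE zE subrr normr0 /b !mul0r.
  move=> t /andP[h1 h2]; have -> : t = 0 by apply/le_anti; rewrite h1 h2.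
  by rewrite wE zE subrr normr0 ltW.
have [u [y [w [tr yE wE wz H]]]] := IH (ltnW iN).
set a := i%:R * d in tr wz H *.
have aE : i.+1%:R * d = a + d by rewrite -natr1 mulrDl mul1r.
have a0 : 0 <= a by rewrite mulr_ge0// ltW.
have adT : a + d <= T by rewrite -aE -[leRHS]NdE ler_wpM2r ?(ltW d0)// ler_nat.
have aad : a < a + d by rewrite ltrDl.
(* [p] is close to the mean velocity of [z] on the cell and lies in the hull at the left end [z a],
   from which [z] departs by at most [M * d]. *)
have [||p Hp zp] := @Z_incl_increment z Zz a (a + d) (z a) (M * d) kap a0 aad adT.
- move=> x /andP[ax xad]; apply: le_trans (zM a x a0 ax _) _; first lra.
  by rewrite ler_wpM2l//; lra.
- exact: kap0.
have [x' [w' [mv Hw']]] := hull_step free gM L0 gL (y a) (w a) kap0 (ltW d0) Hp.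
have [u1 [y1 [w1 [tr1 y1E w1E _ w1E']]]] := mv a.
have [_ _ _ w1M _] := tr1.
rewrite aE; exists (glue a u u1), (glue a y y1), (glue a w w1).
have wz_end : `|w' - z (a + d)| <= b i.+1.
  apply: le_trans (bS i).
  rewrite (_ : a + d - a = d) in zp; last by ring.
  have -> : w' - z (a + d) = (w' - w a - d *: p) - (z (a + d) - z a - d *: p)
      + (w a - z a).
    by apply/matrixP => i' j; rewrite !mxE; ring.
  rewrite (le_trans (ler_normD _ _))//.
  have n1 := ler_normB (w' - w a - d *: p) (z (a + d) - z a - d *: p).
  have n2 : d * (L * `|w a - z a|) <= d * (L * b i).
    by rewrite ler_wpM2l ?(ltW d0)// ler_wpM2l.
  have n3 : d * (3 * L * M * d) <= d * kap by rewrite ler_wpM2l ?(ltW d0).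
  lra.
split.
- by apply: traj_glue tr tr1 _ _.
- by rewrite glue_left.
- by rewrite glue_left.
- by rewrite glue_right ?w1E' ?w1E// ltW.
- move=> t /andP[t0 tad]; have [ta|/ltW at_] := leP t a.
    by rewrite glue_left//; apply: H; rewrite t0.
  rewrite glue_right//.
  have h1 := w1M a t (lexx _) at_ tad; have h2 := zM a t a0 at_ (le_trans tad adT).
  have h3 : M * (t - a) <= M * d by rewrite ler_wpM2l//; lra.
  have h4 := be i (ltnW iN).
  (* Inside the cell each curve moves by at most [M * d], in addition to the error at the left
     end. *)
  have -> : z t - w1 t = (z t - z a) - (w1 t - w1 a) - (w a - z a).
    by rewrite w1E; apply/matrixP => i' j; rewrite !mxE; ring.
  rewrite (le_trans (ler_normB _ _))//.
  have := ler_normB (z t - z a) (w1 t - w1 a); lra.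
Qed.

End RelaxationTheorem.

(** * Controllability for every epsilon, and conclusion *)

Lemma iter_mulmxZ (R : realType) (m k : nat) (A : 'M[R]_m) (B : 'M[R]_(m, k)) (c : R) i :
  iter i (mulmx (c *: A)) (c *: B) = c ^+ i.+1 *: iter i (mulmx A) B.
Proof.
elim: i => [|i IH] /=; first by rewrite expr1.
by rewrite IH -scalemxAl -scalemxAr scalerA -exprS.
Qed.

(** The block [A^i B] is multiplied by the nonzero scalar [c ^+ i.+1], so the left kernel stays the
    same. With [c = eps^-1] this gives controllability of the system divided by [eps]. *)
Lemma row_free_ctrbZ (R : realType) (m k l : nat) (A : 'M[R]_m) (B : 'M[R]_(m, k)) (c : R) :
  c != 0 -> row_free (ctrb A B l) -> row_free (ctrb (c *: A) (c *: B) l).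
Proof.
move=> c0 free; apply: row_free_ker => xi /mul_ctrb_eq0 H.
apply/eqP; rewrite -(mulmx_free_eq0 xi free); apply/eqP/mul_ctrb_eq0 => i il.
have := H i il; rewrite iter_mulmxZ -scalemxAr => /eqP.
by rewrite scaler_eq0 expf_eq0 (negbTE c0) andbF /= => /eqP.
Qed.

Theorem theorem1 (R : realType) (m k n : nat)
  (hm : (0 < m)%N) (hk : (0 < k)%N) (hn : (0 < n)%N)
  (A : 'M[R]_m) (B : 'M[R]_(m, k))
  (hrank : \rank (ctrb A B m) = m)
  (g : 'cV[R]_k -> 'cV[R]_m -> 'cV[R]_n -> 'cV[R]_n)
  (hgmeas : borel_measurable
              (fun p : 'cV[R]_k * 'cV[R]_m * 'cV[R]_n => g p.1.1 p.1.2 p.2))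
  (hgbdd : exists Mg : R, forall u y z, `|g u y z| <= Mg)
  (hglip : exists L : R, forall u y1 z1 y2 z2,
      `|g u y1 z1 - g u y2 z2| <= L * (`|y1 - y2| + `|z1 - z2|))
  (y0 : 'cV[R]_m) (z0 : 'cV[R]_n) (T : R) (hT : 0 < T) :
  forall eps : R, 0 < eps ->
    unif_closure T (Z_eps A B g y0 z0 T eps) = Z_incl g z0 T.
Proof.
move=> eps eps0; have [M gM] := hgbdd; have [L gL] := hglip.
have gL' u y1 z1 y2 z2 : `|g u y1 z1 - g u y2 z2| <= `|L| * (`|y1 - y2| + `|z1 - z2|).
  by apply: le_trans (gL _ _ _ _ _) _; rewrite ler_wpM2r ?addr_ge0// ler_norm.
have free : row_free (ctrb (eps^-1 *: A) (eps^-1 *: B) m).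
  apply: row_free_ctrbZ; first by rewrite invr_eq0 gt_eqF.
  by rewrite /row_free hrank.
apply/seteqP; split.
  exact: (unif_closure_Z_incl gM (normr_ge0 L) gL' hT) (@Z_eps_sub_Z_incl _ _ _ _ g y0 z0 T A B eps).
move=> z Zz e e0.
have [w Zw H] := Z_incl_approx gM (normr_ge0 L) gL' y0 hT eps0 free Zz e0.
by exists w => // t; rewrite /= in_itv; exact: H.
Qed.
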